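(* Let $\Omega\subset\mathbb{R}^d$ be compact and let $\Lambda^\star:\mathcal{P}(\Omega)\times\Omega\to\mathbb{R}^{d'}$ be continuous, where $\mathcal{P}(\Omega)$ carries the weak$^*$ topology and $\Omega$ the Euclidean topology. Then for every $\varepsilon>0$ there exist $L\in\mathbb{N}$, unmasked multi-head attention parameters $\theta_1,\dots,\theta_L$ and MLPs $F_{\xi_1},\dots,F_{\xi_L}$ such that $$\forall(\mu,x)\in\mathcal{P}(\Omega)\times\Omega,\qquad \big|F_{\xi_L}\diamond\Gamma_{\theta_L}\diamond\cdots\diamond F_{\xi_1}\diamond\Gamma_{\theta_1}(\mu,x)-\Lambda^\star(\mu,x)\big|\le\varepsilon,$$ and, for every $\ell$, $d_{\mathrm{in}}(\theta_\ell)\le d+3d'$, $d_{\mathrm{head}}(\theta_\ell)=k(\theta_\ell)=1$ and $H(\theta_\ell)\le d'$.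
   Context: Unmasked attention: a parameter $\theta=(W^h,K^h,Q^h,V^h)_{h=1}^H$ with $K^h,Q^h\in\mathbb{R}^{k\times d_{\mathrm{in}}}$, $V^h\in\mathbb{R}^{d_{\mathrm{head}}\times d_{\mathrm{in}}}$, $W^h\in\mathbb{R}^{d_{\mathrm{in}}\times d_{\mathrm{head}}}$; write $d_{\mathrm{in}}(\theta),d_{\mathrm{head}}(\theta),k(\theta),H(\theta)$ for these sizes. For a compactly supported probability measure $\mu$ on $\mathbb{R}^{d_{\mathrm{in}}}$ and $x\in\mathbb{R}^{d_{\mathrm{in}}}$, $$\Gamma_\theta(\mu,x)=x+\sum_{h=1}^H W^h\int\frac{\exp(\frac{1}{\sqrt k}\langle Q^hx,K^hy\rangle)}{\int\exp(\frac{1}{\sqrt k}\langle Q^hx,K^hz\rangle)\,d\mu(z)}V^hy\,d\mu(y).$$ We write $\Gamma(\mu)$ for the map $x\mapsto\Gamma(\mu,x)$. An MLP is a map $A_K\circ\rho\circ A_{K-1}\circ\cdots\circ\rho\circ A_1$ between Euclidean spaces with affine $A_j$ and ReLU activation $\rho$ applied componentwise (affine maps are the case $K=1$); an MLP $F$ is regarded as a context-free in-context map $F(\mu,x)=F(x)$. In-context composition: $(\Gamma_2\diamond\Gamma_1)(\mu,x)=\Gamma_2(\Gamma_1(\mu)_\sharp\mu,\Gamma_1(\mu,x))$, where $\sharp$ denotes push-forward. Dimensions are compatible: $d_{\mathrm{in}}(\theta_1)=d$, $F_{\xi_\ell}:\mathbb{R}^{d_{\mathrm{in}}(\theta_\ell)}\to\mathbb{R}^{d_{\mathrm{in}}(\theta_{\ell+1})}$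 for $\ell<L$, and $F_{\xi_L}$ maps into $\mathbb{R}^{d'}$. *)

(* Defs.v *)
From HB Require Import structures.
From mathcomp Require Import all_boot all_order all_algebra.
From mathcomp Require Import all_classical all_reals all_analysis.
Set Implicit Arguments.
Unset Strict Implicit.
Unset Printing Implicit Defensive.
Import Order.TTheory GRing.Theory Num.Theory.
Import numFieldNormedType.Exports.
Local Open Scope classical_set_scope.
Local Open Scope ring_scope.

Section Defs.
Variable R : realType.

Definition borel (n : nat) := g_sigma_algebraType (@open 'cV[R]_n).

Definition meas (n : nat) := set (borel n) -> \bar R.

Definition icmap (n m : nat) := meas n -> 'cV[R]_n -> 'cV[R]_m.

(** Real-valued integral (same as MathComp-Analysis' Rintegral, but for a
    set function). *)
Definition rint (n : nat) (mu : meas n) (f : 'cV[R]_n -> R) : R :=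
  fine (\int[mu]_(y in [set: borel n]) (f y)%:E)%E.

Definition vint (n m : nat) (mu : meas n) (f : 'cV[R]_n -> 'cV[R]_m) : 'cV[R]_m :=
  \col_i rint mu (fun y => f y i 0).

Definition dotv (n : nat) (a b : 'cV[R]_n) : R := \sum_i a i 0 * b i 0.
Definition enorm (n : nat) (a : 'cV[R]_n) : R := Num.sqrt (dotv a a).

Record att_param (din : nat) := AttParam {
  nheads : nat;
  kdim : nat;
  dhead : nat;
  Wm : 'I_nheads -> 'M[R]_(din, dhead);
  Km : 'I_nheads -> 'M[R]_(kdim, din);
  Qm : 'I_nheads -> 'M[R]_(kdim, din);
  Vm : 'I_nheads -> 'M[R]_(dhead, din)
}.
Arguments Wm {din} a h.
Arguments Km {din} a h.
Arguments Qm {din} a h.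
Arguments Vm {din} a h.

Definition attention (din : nat) (th : att_param din) : icmap din din :=
  fun mu x =>
    let sc h y := expR ((Num.sqrt (kdim th)%:R)^-1 *
                        dotv (Qm th h *m x) (Km th h *m y)) in
    x + \sum_(h < nheads th)
          Wm th h *m vint mu (fun y => (sc h y / rint mu (sc h)) *: (Vm th h *m y)).

Definition relu (n : nat) (v : 'cV[R]_n) : 'cV[R]_n := map_mx (fun t => Num.max t 0) v.

Inductive mlp : nat -> nat -> Type :=
| MLPAff (n m : nat) (A : 'M[R]_(m, n)) (b : 'cV[R]_m) : mlp n m
| MLPLayer (n p m : nat) (A : 'M[R]_(p, n)) (b : 'cV[R]_p) (rest : mlp p m) : mlp n m.

Fixpoint mlp_eval (n m : nat) (F : mlp n m) : 'cV[R]_n -> 'cV[R]_m :=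
  match F in mlp n m return 'cV[R]_n -> 'cV[R]_m with
  | MLPAff _ _ A b => fun x => A *m x + b
  | MLPLayer _ _ _ A b rest => fun x => mlp_eval rest (relu (A *m x + b))
  end.

Definition mlp_ic (n m : nat) (F : mlp n m) : icmap n m := fun _ x => mlp_eval F x.

Definition pushf (n m : nat) (mu : meas n) (f : 'cV[R]_n -> 'cV[R]_m) : meas m :=
  fun A => mu (f @^-1` A).

Definition icomp (n p m : nat) (G : icmap p m) (F : icmap n p) : icmap n m :=
  fun mu x => G (pushf mu (F mu)) (F mu x).

(** Networks F_{xi_L} <> Gamma_{theta_L} <> ... <> F_{xi_1} <> Gamma_{theta_1},
    L >= 1, with dimensions d_in(theta_1) = n, F_{xi_l} : R^{d_in(theta_l)} ->
    R^{d_in(theta_{l+1})}, F_{xi_L} into R^m. *)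
Inductive tnet : nat -> nat -> Type :=
| NetLast (n m : nat) (th : att_param n) (F : mlp n m) : tnet n m
| NetCons (n p m : nat) (th : att_param n) (F : mlp n p) (rest : tnet p m) : tnet n m.

Fixpoint tnet_eval (n m : nat) (N : tnet n m) : icmap n m :=
  match N in tnet n m return icmap n m with
  | NetLast _ _ th F => icomp (mlp_ic F) (attention th)
  | NetCons _ _ _ th F rest =>
      icomp (tnet_eval rest) (icomp (mlp_ic F) (attention th))
  end.

Fixpoint tnet_all (n m : nat) (P : forall din, att_param din -> Prop) (N : tnet n m) : Prop :=
  match N with
  | NetLast _ _ th _ => P _ th
  | NetCons _ _ _ th _ rest => P _ th /\ tnet_all P rest
  end.

(** Continuity of Lambda on P(Omega) x Omega, where P(Omega) (probability
    measures on R^d concentrated on Omega) carries the weak-* topology, i.e.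
    the coarsest topology making nu |-> \int f dnu continuous for every
    f in C(Omega), and Omega carries the Euclidean topology; the product
    topology is used.  Written out with the standard neighbourhood base. *)
Definition weakstar_continuous (d d' : nat) (Om : set 'cV[R]_d)
    (Lam : probability (borel d) R -> 'cV[R]_d -> 'cV[R]_d') : Prop :=
  forall (mu : probability (borel d) R) (x : 'cV[R]_d),
    mu Om = 1%E -> Om x ->
    forall e : R, 0 < e ->
      exists (N : nat) (f : 'I_N -> 'cV[R]_d -> R) (delta : R),
        0 < delta /\
        (forall i, {within Om, continuous (f i)}) /\
        forall (nu : probability (borel d) R) (y : 'cV[R]_d),
          nu Om = 1%E -> Om y ->
          (forall i, `| fine (\int[nu]_(z in (Om : set (borel d))) (f i z)%:E)%E
                       - fine (\int[mu]_(z in (Om : set (borel d))) (f i z)%:E)%E | < delta) ->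
          enorm (y - x) < delta ->
          enorm (Lam nu y - Lam mu x) < e.

End Defs.

(* Main.v *)
Require Import Defs.
From HB Require Import structures.
From mathcomp Require Import all_boot all_order all_algebra.
From mathcomp Require Import all_classical all_reals all_analysis.
From mathcomp Require Import measurable_realfun ring lra zify.
Import Order.TTheory GRing.Theory Num.Theory.
Import numFieldNormedType.Exports.
Local Open Scope classical_set_scope.
Local Open Scope ring_scope.

(** A head whose query and key matrices vanish has uniform softmax
    weights, so it computes the exact mean [\int g dmu] of any ReLU function [g] that
    the preceding MLP wrote in a register.  ReLU layers also compute maxima and minima
    exactly, hence a network with the token [x], one accumulator per output and two
    scratch registers evaluates every [max_n min_m (g_nm x + b_nm * \int g'_nm dmu)]
    without error.  The set P(Om) x Om is compact, and these elementary functions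
    separate the points that [Lam] separates (ReLU functions are dense in C(Om) by the
    same lattice argument), so the lattice form of the Stone-Weierstrass theorem gives
    the approximation.

    For the compactness of P(Om), let U be an ultrafilter of probability measures.
    Coding the points of Om by their positions relative to countably many rational
    half-spaces, the U-limits of the masses of the cylinders cut [0, 1[ into nested
    intervals; mapping t to the point of Om whose cylinders contain t pushes Lebesgue
    measure to the U-limit. *)

Set Implicit Arguments.
Unset Strict Implicit.
Unset Printing Implicit Defensive.

(** * Ultrafilters, finite covers and lattice approximation *)

Lemma cvg_minr (R : realType) (T : Type) (U : set_system T) {FU : Filter U}
    (f g : T -> R) (a b : R) :
  f @ U --> a -> g @ U --> b -> (fun x => Num.min (f x) (g x)) @ U --> Num.min a b.
Proof.
move=> /cvgrPdist_lt fa /cvgrPdist_lt gb; apply/cvgrPdist_lt => e e0.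
apply: filterS2 (fa e e0) (gb e e0) => x /=.
rewrite !ltr_norml => /andP[? ?] /andP[? ?].
by case: (leP a b) => ?; case: (leP (f x)) => ?; apply/andP; split; lra.
Qed.

Lemma cvg_maxr (R : realType) (T : Type) (U : set_system T) {FU : Filter U}
    (f g : T -> R) (a b : R) :
  f @ U --> a -> g @ U --> b -> (fun x => Num.max (f x) (g x)) @ U --> Num.max a b.
Proof.
move=> /cvgrPdist_lt fa /cvgrPdist_lt gb; apply/cvgrPdist_lt => e e0.
apply: filterS2 (fa e e0) (gb e e0) => x /=.
rewrite !ltr_norml => /andP[? ?] /andP[? ?].
by case: (leP a b) => ?; case: (leP (f x)) => ?; apply/andP; split; lra.
Qed.

(** If no finite union covered [D], the complements of these unions in [D] would generate a proper
    filter, and an ultrafilter above it contains the complement of [V p] for every [p] in [D].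
    Compactness is phrased through ultrafilters, so [T] carries no topology. *)
Lemma ultra_finite_cover (T : Type) (D : set T) (V : T -> set T) :
  (forall U : set_system T, UltraFilter U -> U D ->
     exists p, D p /\ U (V p)) ->
  exists s : seq T, forall x, D x -> has (fun p => `[< D p /\ V p x >]) s.
Proof.
move=> DV; apply/not_existsP => nocov.
pose un (s : seq T) := [set x | has (fun p => `[< D p /\ V p x >]) s].
pose F := [set A : set T | exists s, D `\` un s `<=` A].
have FF : ProperFilter F.
  apply: Build_ProperFilter; last split.
  - case=> s sA; apply: (nocov s) => x Dx; apply/negP => xs.
    by apply: (sA x); split=> // /(negP xs).
  - by exists [::].
  - move=> A B [s sA] [t tB]; exists (s ++ t) => x [Dx]; rewrite /un /= has_cat => nx.
    by split; [apply: sA|apply: tB]; split=> //= h; apply: nx; rewrite h ?orbT.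
  - by move=> A B AB [s sA]; exists s; exact: subset_trans AB.
have [U [UU FU]] := ultraFilterLemma FF.
have [|p [Dp UVp]] := DV U UU; first by apply: FU; exists [::] => x [].
have : U (V p `&` ~` un [:: p]).
  apply: filterI => //; apply: FU; exists [:: p] => x []//.
by move=> /filter_ex[x [Vx]]; apply; rewrite /un /= orbF; apply/asboolP.
Qed.

(* Kakutani-Stone: the minima taken over a finite cover give functions below
   [F + e] that agree with [F] at one point, and a finite maximum of those is
   also above [F - e]. The classes [A], [B], [C] are kept apart because a network with
   a bounded number of registers cannot evaluate nested minima and maxima. *)
Lemma lattice_approximation (R : realType) (T : Type) (D : set T)
    (A B C : set (T -> R)) (F : T -> R) :
  (forall U : set_system T, UltraFilter U -> U D -> exists p,
     [/\ D p, F @ U --> F p & forall f, A f -> f @ U --> f p]) ->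
  (forall p q, D p -> D q -> exists f, [/\ A f, f p = F p & f q = F q]) ->
  A `<=` B ->
  (forall f g, B f -> A g -> B (fun x => Num.min (f x) (g x))) ->
  B `<=` C ->
  (forall f g, C f -> B g -> C (fun x => Num.max (f x) (g x))) ->
  D !=set0 ->
  forall e : R, 0 < e -> exists2 f, C f & forall x, D x -> `|f x - F x| < e.
Proof.
move=> DU AF AB Bmin BC Cmax [x0 Dx0] e e0.
(* Convergence relative to [F] and [A]: this property passes from [A] to finite minima, which lets
   the second cover be extracted. *)
pose cont (f : T -> R) := forall (U : set_system T) p, UltraFilter U -> U D ->
  D p -> F @ U --> F p -> (forall f, A f -> f @ U --> f p) -> f @ U --> f p.
have below p : D p -> exists2 b, B b /\ cont b &
    b p = F p /\ forall x, D x -> b x < F x + e.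
  move=> Dp.
  have /choice[a aP] : forall q, exists a : T -> R, D q ->
      [/\ A a, a p = F p & a q = F q].
    move=> q; have [Dq|nDq] := pselect (D q); last by exists (cst 0).
    by have [f [Af fp fq]] := AF p q Dp Dq; exists f.
  have [|s sP] := @ultra_finite_cover T D (fun q => [set x | a q x < F x + e]).
    move=> U UU UD; have [q [Dq FU AU]] := DU U UU UD.
    exists q; split=> //; have [Aa _ aq] := aP q Dq.
    have : (fun x => F x - a q x) @ U --> F q - a q q.
      by apply: cvgB => //; exact: AU.
    rewrite aq subrr => /cvgrPdist_lt/(_ e e0).
    apply: filterS => x /=; rewrite sub0r normrN => /ltr_normlP[+ _].
    by rewrite opprB ltrBlDr addrC.
  suff [b Bb [bp bs]] : exists2 b, B b /\ cont b & b p = F p /\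
      forall x, D x -> has (fun q => `[< D q /\ a q x < F x + e >]) s ->
        b x < F x + e.
    by exists b => //; split=> // x Dx; apply: bs => //; exact: sP.
  have aB q : D q -> B (a q) /\ cont (a q).
    move=> Dq; have [Aa _ _] := aP q Dq; split; first exact: AB.
    by move=> U p' UU UD Dp' FU; apply.
  (* The minimum starts from [a p], so it takes the value [F p] at [p] even for an empty list;
     points of the list outside [D] are skipped. *)
  elim: s {sP} => [|q s [b [Bb cb] [bp bs]]].
    by have [Aa ap _] := aP p Dp; exists (a p) => //; exact: aB.
  have [Dq|nDq] := pselect (D q); last first.
    exists b => //; split=> // x Dx /= /orP[/asboolP[]//|]; exact: bs.
  have [Aa ap _] := aP q Dq; have [Baq caq] := aB q Dq.
  exists (fun x => Num.min (b x) (a q x)).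
    split; first exact: Bmin.
    move=> U p' UU UD Dp' FU AU.
    by apply: cvg_minr; [exact: cb|exact: caq].
  split; first by rewrite bp ap minxx.
  move=> x Dx /= /orP[/asboolP[_ h]|h]; rewrite gt_min.
    by rewrite h orbT.
  by rewrite bs.
have /choice[b bP] : forall p, exists b : T -> R, D p ->
    [/\ B b, cont b, b p = F p & forall x, D x -> b x < F x + e].
  move=> p; have [Dp|nDp] := pselect (D p); last by exists (cst 0).
  by have [b [? ?] [? ?]] := below p Dp; exists b.
have [|s sP] := @ultra_finite_cover T D (fun q => [set x | F x - e < b q x]).
  move=> U UU UD; have [q [Dq FU AU]] := DU U UU UD.
  exists q; split=> //; have [Bb cb bq _] := bP q Dq.
  have : (fun x => F x - b q x) @ U --> F q - b q q.
    by apply: cvgB => //; exact: cb.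
  rewrite bq subrr => /cvgrPdist_lt/(_ e e0).
  apply: filterS => x /=; rewrite sub0r normrN => /ltr_normlP[_].
  by rewrite ltrBlDr -ltrBlDl.
suff [f Cf [f1 f2]] : exists2 f, C f & (forall x, D x -> f x < F x + e) /\
    forall x, D x -> has (fun q => `[< D q /\ F x - e < b q x >]) s ->
      F x - e < f x.
  exists f => // x Dx; rewrite ltr_norml; apply/andP; split.
    by rewrite ltrBrDl; apply: f2 => //; exact: sP.
  by rewrite ltrBlDl; exact: f1.
elim: s {sP} => [|q s [f Cf [f1 f2]]].
  by have [Bb _ _ h] := bP x0 Dx0; exists (b x0); [exact: BC|].
have [Dq|nDq] := pselect (D q); last first.
  exists f => //; split=> // x Dx /= /orP[/asboolP[]//|]; exact: f2.
have [Bb _ _ h] := bP q Dq.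
exists (fun x => Num.max (f x) (b q x)); first exact: Cmax.
split=> x Dx; first by rewrite gt_max f1// h.
move=> /= /orP[/asboolP[_ h']|h']; rewrite lt_max; first by rewrite h' orbT.
by rewrite f2.
Qed.

(** * Closure properties of functions computed by ReLU networks *)

Section MLPFunctions.
Context {R : realType}.

Definition is_mlp {n m : nat} (f : 'cV[R]_n -> 'cV[R]_m) : Prop :=
  exists F : mlp R n m, mlp_eval F =1 f.

Definition is_smlp {n : nat} (g : 'cV[R]_n -> R) : Prop :=
  is_mlp (fun x => (g x)%:M : 'cV[R]_1).

Lemma eq_is_mlp {n m} (f g : 'cV[R]_n -> 'cV[R]_m) :
  f =1 g -> is_mlp f -> is_mlp g.
Proof. by move=> fg [F Ff]; exists F => x; rewrite Ff. Qed.

Lemma eq_is_smlp {n} (f g : 'cV[R]_n -> R) : f =1 g -> is_smlp f -> is_smlp g.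
Proof. by move=> fg; apply: eq_is_mlp => x; rewrite fg. Qed.

Lemma is_mlp_affine {n m} (A : 'M[R]_(m, n)) (b : 'cV[R]_m) :
  is_mlp (fun x => A *m x + b).
Proof. by exists (MLPAff A b). Qed.

Lemma is_mlp_linear {n m} (A : 'M[R]_(m, n)) : is_mlp (mulmx A : 'cV[R]_n -> _).
Proof. by apply: eq_is_mlp (is_mlp_affine A 0) => x; rewrite addr0. Qed.

Lemma is_mlp_relu {n} : is_mlp (@relu R n).
Proof.
exists (MLPLayer 1%:M 0 (MLPAff 1%:M 0)) => x /=.
by rewrite !mul1mx !addr0.
Qed.

(** Networks begin and end with an affine map, so the last one of [F] merges with the first one of
    [G]. *)
Lemma is_mlp_comp {n p m} (f : 'cV[R]_n -> 'cV[R]_p) (g : 'cV[R]_p -> 'cV[R]_m) :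
  is_mlp f -> is_mlp g -> is_mlp (g \o f).
Proof.
move=> [F Ff] [G Gg].
suff [H HE] : exists H : mlp R n m, forall x, mlp_eval H x = mlp_eval G (mlp_eval F x).
  by exists H => x; rewrite HE Ff Gg.
elim: F {f Ff} G {g Gg} => {n p} [n p A b|n q p A b F IH] G.
- case: p m / G A b => [p' m' A' b'|p' r m' A' b' G] A b.
    exists (MLPAff (A' *m A) (A' *m b + b')) => x /=.
    by rewrite mulmxDr mulmxA addrA.
  exists (MLPLayer (A' *m A) (A' *m b + b') G) => x /=.
  by rewrite mulmxDr mulmxA addrA.
- have [H HE] := IH G; exists (MLPLayer A b H) => x /=; exact: HE.
Qed.

Lemma is_mlp_usubmx {n m} : is_mlp (@usubmx R n m 1).
Proof.
apply: eq_is_mlp (is_mlp_linear (row_mx 1%:M 0)) => x /=.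
by rewrite -[x in LHS]vsubmxK mul_row_col mul1mx mul0mx addr0.
Qed.

Lemma is_mlp_dsubmx {n m} : is_mlp (@dsubmx R n m 1).
Proof.
apply: eq_is_mlp (is_mlp_linear (row_mx 0 1%:M)) => x /=.
by rewrite -[x in LHS]vsubmxK mul_row_col mul1mx mul0mx add0r.
Qed.

(* [y] is carried through a ReLU layer as [relu y - relu (- y)]. *)
Lemma is_mlp_pass {n m} k (f : 'cV[R]_n -> 'cV[R]_m) : is_mlp f ->
  is_mlp (fun z : 'cV_(n + k) => col_mx (f (usubmx z)) (dsubmx z)).
Proof.
move=> [F Ff].
suff [H HE] : is_mlp (fun z : 'cV_(n + k) =>
    col_mx (mlp_eval F (usubmx z)) (dsubmx z)) by exists H => z; rewrite HE Ff.
elim: F {f Ff} => {n m} [n m A b|n p m A b F IH].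
- apply: eq_is_mlp (is_mlp_affine (block_mx A 0 0 1%:M) (col_mx b 0)) => z.
  rewrite -[z in LHS]vsubmxK mul_block_col !mul0mx mul1mx add_col_mx /=.
  by rewrite !addr0 add0r.
- pose f1 (z : 'cV_(n + k)) : 'cV_(p + (k + k)) :=
    col_mx (A *m usubmx z + b) (col_mx (dsubmx z) (- dsubmx z)).
  pose f2 (z : 'cV[R]_(p + (k + k))) : 'cV_(p + k) :=
    col_mx (usubmx z) (usubmx (dsubmx z) - dsubmx (dsubmx z)).
  have f1P : is_mlp f1.
    apply: eq_is_mlp (is_mlp_affine
      (col_mx (row_mx A 0) (col_mx (row_mx 0 1%:M) (row_mx 0 (- 1%:M))))
      (col_mx b 0)) => z.
    rewrite -[z in LHS]vsubmxK !mul_col_mx !mul_row_col add_col_mx.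
    by rewrite !mul0mx mul1mx mulNmx mul1mx !add0r !addr0.
  have f2P : is_mlp f2.
    apply: eq_is_mlp (is_mlp_linear
      (block_mx 1%:M 0 0 (row_mx 1%:M (- 1%:M)))) => z.
    rewrite -[z in LHS]vsubmxK mul_block_col !mul0mx mul1mx add0r addr0.
    rewrite -[dsubmx z in LHS]vsubmxK mul_row_col mul1mx mulNmx mul1mx.
    by [].
  apply: eq_is_mlp (is_mlp_comp (is_mlp_comp (is_mlp_comp f1P is_mlp_relu) f2P) IH).
  move=> z /=; rewrite /f2 /f1 /relu !map_col_mx !(col_mxKu, col_mxKd).
  congr (col_mx _ _); apply/colP => i; rewrite !mxE.
  by case: leP => ?; case: leP => ?; lra.
Qed.

(** The two networks may have different depths, so they run one after the other: the input is
    duplicated, and each half is processed while the other is carried along. *)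
Lemma is_mlp_col_mx {n m1 m2} (f : 'cV[R]_n -> 'cV[R]_m1) (g : 'cV[R]_n -> 'cV[R]_m2) :
  is_mlp f -> is_mlp g -> is_mlp (fun x => col_mx (f x) (g x)).
Proof.
move=> fP gP.
have dup : is_mlp (fun x : 'cV[R]_n => col_mx x x).
  apply: eq_is_mlp (is_mlp_linear (col_mx 1%:M 1%:M)) => x.
  by rewrite mul_col_mx mul1mx.
have swap : is_mlp (fun z : 'cV[R]_(m1 + n) => col_mx (dsubmx z) (usubmx z)).
  apply: eq_is_mlp (is_mlp_linear (block_mx 0 1%:M 1%:M 0)) => z.
  by rewrite -[z in LHS]vsubmxK mul_block_col !mul0mx !mul1mx add0r addr0.
have swap' : is_mlp (fun z : 'cV[R]_(m2 + m1) => col_mx (dsubmx z) (usubmx z)).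
  apply: eq_is_mlp (is_mlp_linear (block_mx 0 1%:M 1%:M 0)) => z.
  by rewrite -[z in LHS]vsubmxK mul_block_col !mul0mx !mul1mx add0r addr0.
apply: eq_is_mlp (is_mlp_comp dup (is_mlp_comp (is_mlp_pass n fP)
  (is_mlp_comp swap (is_mlp_comp (is_mlp_pass m1 gP) swap')))).
by move=> x /=; rewrite !(col_mxKu, col_mxKd).
Qed.

Lemma is_mlp_coord {n m} (f : 'cV[R]_n -> 'cV[R]_m) :
  (forall i, is_smlp (fun x => f x i 0)) -> is_mlp f.
Proof.
elim: m f => [|m IH] f fP.
  by apply: eq_is_mlp (is_mlp_linear 0) => x; rewrite [f x]flatmx0 [LHS]flatmx0.
pose f' x : 'cV[R]_(1 + m) := f x.
apply: (@eq_is_mlp _ _ (fun x => col_mx (f' x 0 0)%:M (dsubmx (f' x)))).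
  move=> x; rewrite -/(f' x) -[RHS]vsubmxK; congr (col_mx _ _).
  by rewrite [RHS]mx11_scalar mxE lshift0.
apply: is_mlp_col_mx; first exact: fP.
apply: IH => i; apply: eq_is_smlp (fP (rshift 1 i)) => x.
by rewrite mxE.
Qed.

Lemma is_mlp_scoord {n m} (f : 'cV[R]_n -> 'cV[R]_m) i :
  is_mlp f -> is_smlp (fun x => f x i 0).
Proof.
move=> fP; apply: eq_is_mlp (is_mlp_comp fP (is_mlp_linear (delta_mx 0 i))) => x /=.
by rewrite -rowE; apply/matrixP => a b; rewrite !ord1 !mxE eqxx mulr1n.
Qed.

Lemma is_mlp_id {n} : is_mlp (fun x : 'cV[R]_n => x).
Proof. by apply: eq_is_mlp (is_mlp_linear 1%:M) => x; rewrite mul1mx. Qed.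

Lemma is_smlp_coord {n} i : is_smlp (fun x : 'cV[R]_n => x i 0).
Proof. exact: is_mlp_scoord is_mlp_id. Qed.

Lemma is_smlp_comp {n m} (f : 'cV[R]_n -> 'cV[R]_m) (g : 'cV[R]_m -> R) :
  is_mlp f -> is_smlp g -> is_smlp (fun x => g (f x)).
Proof. exact: is_mlp_comp. Qed.

Lemma is_smlp_cst {n} (c : R) : is_smlp (fun _ : 'cV[R]_n => c).
Proof. by apply: eq_is_mlp (is_mlp_affine 0 c%:M) => x; rewrite mul0mx add0r. Qed.

Lemma is_smlpD {n} (f g : 'cV[R]_n -> R) :
  is_smlp f -> is_smlp g -> is_smlp (fun x => f x + g x).
Proof.
move=> fP gP; apply: eq_is_mlp (is_mlp_comp (is_mlp_col_mx fP gP)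
  (is_mlp_linear (row_mx 1%:M 1%:M))) => x /=.
by rewrite mul_row_col !mul1mx raddfD.
Qed.

Lemma is_smlpZ {n} c (f : 'cV[R]_n -> R) : is_smlp f -> is_smlp (fun x => c * f x).
Proof.
move=> fP; apply: eq_is_mlp (is_mlp_comp fP (is_mlp_linear c%:M)) => x /=.
by rewrite -scalar_mxM.
Qed.

Lemma is_smlpB {n} (f g : 'cV[R]_n -> R) :
  is_smlp f -> is_smlp g -> is_smlp (fun x => f x - g x).
Proof.
move=> fP gP; apply: eq_is_smlp (is_smlpD fP (is_smlpZ (-1) gP)) => x.
by rewrite mulN1r.
Qed.

Lemma is_smlp_relu {n} (f : 'cV[R]_n -> R) :
  is_smlp f -> is_smlp (fun x => Num.max (f x) 0).
Proof.
move=> fP; apply: eq_is_mlp (is_mlp_comp fP is_mlp_relu) => x /=.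
by apply/matrixP => i j; rewrite !ord1 !mxE eqxx !mulr1n.
Qed.

(** The maximum is [g + relu (f - g)]; dually, the minimum is [f - relu (f - g)]. *)
Lemma is_smlp_max {n} (f g : 'cV[R]_n -> R) :
  is_smlp f -> is_smlp g -> is_smlp (fun x => Num.max (f x) (g x)).
Proof.
move=> fP gP; apply: eq_is_smlp (is_smlpD gP
  (is_smlp_relu (is_smlpB fP gP))) => x /=.
by case: leP => ?; case: leP => ?; lra.
Qed.

Lemma is_smlp_min {n} (f g : 'cV[R]_n -> R) :
  is_smlp f -> is_smlp g -> is_smlp (fun x => Num.min (f x) (g x)).
Proof.
move=> fP gP; apply: eq_is_smlp (is_smlpB fP
  (is_smlp_relu (is_smlpB fP gP))) => x /=.
by case: leP => ?; case: leP => ?; lra.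
Qed.

End MLPFunctions.

(** * Convergence, Borel measurability and integrals *)

Section BorelFunctions.
Context {R : realType}.

Lemma cvg_sumr (T I : Type) (F : set_system T) {FF : Filter F} (r : seq I)
    (P : pred I) (f : I -> T -> R) (l : I -> R) :
  (forall i, P i -> f i @ F --> l i) ->
  \sum_(i <- r | P i) f i x @[x --> F] --> \sum_(i <- r | P i) l i.
Proof.
move=> fl; elim: r => [|i r IH].
  under eq_fun do rewrite big_nil.
  by rewrite big_nil; exact: cvg_cst.
under eq_fun do rewrite big_cons.
by rewrite big_cons; case: ifP => // Pi; apply: cvgD => //; exact: fl.
Qed.

Lemma cvg_cV (T : Type) (F : set_system T) {FF : Filter F} n
    (f : T -> 'cV[R]_n) (l : 'cV[R]_n) :
  (forall i, f x i 0 @[x --> F] --> l i 0) -> f @ F --> l.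
Proof.
move=> fl A [P lP PA]; rewrite /nbhs /=.
apply: (@filterS _ _ _ _ _ (fun x (h : forall i j, P i j (f x i j)) => PA _ h)).
apply: filter_forall => i; apply: filter_forall => j.
by rewrite ord1; apply: fl; rewrite -(ord1 j); exact: lP.
Qed.

Lemma cvg_cV_coord (T : Type) (F : set_system T) {FF : Filter F} n
    (f : T -> 'cV[R]_n) (l : 'cV[R]_n) i :
  f @ F --> l -> f x i 0 @[x --> F] --> l i 0.
Proof.
by move=> fl; exact: (cvg_comp f (fun x => x i 0) fl (@coord_continuous _ _ _ i 0 l)).
Qed.

(** Stated along an arbitrary filter, to give both continuity and limits along ultrafilters. *)
Lemma mlp_cvg (T : Type) (F : set_system T) {FF : Filter F} n m
    (g : 'cV[R]_n -> 'cV[R]_m) (f : T -> 'cV[R]_n) (l : 'cV[R]_n) :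
  is_mlp g -> f @ F --> l -> g (f t) @[t --> F] --> g l.
Proof.
move=> [G /funext <-].
have affine p q (A : 'M[R]_(q, p)) (b : 'cV[R]_q) (h : T -> 'cV[R]_p) (k : 'cV[R]_p) :
    h @ F --> k -> A *m h t + b @[t --> F] --> A *m k + b.
  move=> hk; apply: cvg_cV => i.
  have -> : (fun t => (A *m h t + b) i 0) =
      fun t => \sum_j A i j * h t j 0 + b i 0 by apply/funext => t; rewrite !mxE.
  have -> : (A *m k + b) i 0 = \sum_j A i j * k j 0 + b i 0 by rewrite !mxE.
  apply: cvgD; last exact: cvg_cst.
  apply: cvg_sumr => j _; apply: cvgM; first exact: cvg_cst.
  exact: cvg_cV_coord.
elim: G f l => {g n m} [n m A b|n p m A b G IH] f l fl /=; first exact: affine.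
apply: IH; apply: cvg_cV => i.
have -> : (fun t => relu (A *m f t + b) i 0) =
    fun t => Num.max ((A *m f t + b) i 0) 0 by apply/funext => t; rewrite mxE.
rewrite mxE; apply: cvg_maxr; last exact: cvg_cst.
by apply: cvg_cV_coord; exact: affine.
Qed.

Lemma smlp_cvg (T : Type) (F : set_system T) {FF : Filter F} n
    (g : 'cV[R]_n -> R) (f : T -> 'cV[R]_n) (l : 'cV[R]_n) :
  is_smlp g -> f @ F --> l -> g (f t) @[t --> F] --> g l.
Proof.
move=> gP fl; have := @cvg_cV_coord _ _ _ _ _ _ 0 (mlp_cvg gP fl).
have E x : ((g x)%:M : 'cV[R]_1) 0 0 = g x by rewrite mxE eqxx mulr1n.
by rewrite E; under eq_fun do rewrite E; apply.
Qed.

Lemma mlp_continuous n m (f : 'cV[R]_n -> 'cV[R]_m) : is_mlp f -> continuous f.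
Proof. by move=> fP x; exact: (mlp_cvg fP (@cvg_id _ (nbhs x))). Qed.

Lemma smlp_continuous n (g : 'cV[R]_n -> R) : is_smlp g -> continuous g.
Proof. by move=> gP x; exact: (smlp_cvg gP (@cvg_id _ (nbhs x))). Qed.

Lemma open_borel n (A : set 'cV[R]_n) : open A -> measurable (A : set (borel R n)).
Proof. exact: sub_sigma_algebra. Qed.

Lemma closed_borel n (A : set 'cV[R]_n) : closed A -> measurable (A : set (borel R n)).
Proof.
by move=> /closed_openC /open_borel; rewrite -[X in _ -> measurable X]setCK;
  exact: measurableC.
Qed.

Lemma compact_borel n (A : set 'cV[R]_n) : compact A -> measurable (A : set (borel R n)).
Proof. by move=> /(compact_closed (@norm_hausdorff _ _)); exact: closed_borel. Qed.

Lemma continuous_borel n m (f : 'cV[R]_n -> 'cV[R]_m) :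
  continuous f -> measurable_fun [set: borel R n] (f : borel R n -> borel R m).
Proof.
move=> /continuousP cf; 
apply: (@measurability _ _ (borel R n) (borel R m) setT f (@open 'cV[R]_m)) => //.
by move=> _ [B oB <-]; rewrite setTI; apply: open_borel; exact: cf.
Qed.

Lemma within_continuous_borel n (D : set 'cV[R]_n) (f : 'cV[R]_n -> R) :
  measurable (D : set (borel R n)) -> {within D, continuous f} ->
  measurable_fun (D : set (borel R n)) (f : borel R n -> R).
Proof.
move=> mD /continuousP cf; apply: (measurability _ (RGenOpens.measurableE R)).
move=> _ [_ [a [b ->] <-]].
have /cf/open_subspaceP[V oV VD] : open (`]a, b[%classic : set R) by exact: interval_open.
by rewrite setIC -VD; apply: measurableI => //; exact: open_borel.
Qed.

Lemma continuous_borel_real n (f : 'cV[R]_n -> R) :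
  continuous f -> measurable_fun [set: borel R n] (f : borel R n -> R).
Proof.
move=> cf; apply: within_continuous_borel => //; exact: continuous_subspaceT.
Qed.

Lemma within_continuous_integrable n (D : set 'cV[R]_n) (f : 'cV[R]_n -> R)
    (mu : probability (borel R n) R) :
  compact D -> {within D, continuous f} ->
  mu.-integrable (D : set (borel R n)) (EFin \o (f : borel R n -> R)).
Proof.
move=> cD cf; have mD := compact_borel cD.
apply: measurable_bounded_integrable => //.
- exact: (le_lt_trans (probability_le1 mu mD)) (ltry _).
- exact: within_continuous_borel.
- have /compact_bounded[M [Mr Mb]] := continuous_compact cf cD.
  exists M; split=> // x Mx y Dy; apply: Mb => //; by exists y.
Qed.

Lemma integral_full_measure (disp : measure_display) (S : measurableType disp)
    (P : probability S R) (D : set S) (f : S -> R) :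
  measurable D -> P D = 1%E -> measurable_fun setT f ->
  (\int[P]_x (f x)%:E = \int[P]_(x in D) (f x)%:E)%E.
Proof.
move=> mD PD /measurable_EFinP mf; rewrite [in RHS]integral_mkcond.
apply: ae_eq_integral => //.
  exact/(measurable_restrictT _ _).1/measurable_funTS.
exists (~` D); split; first exact: measurableC.
  by transitivity (1 - P D)%E; [exact: probability_setC|rewrite PD subee].
by move=> x; apply: contra_not => Dx _; rewrite patchE mem_set.
Qed.

Lemma rint_restrict n (D : set 'cV[R]_n) (f : 'cV[R]_n -> R)
    (mu : probability (borel R n) R) :
  measurable (D : set (borel R n)) -> mu D = 1%E -> continuous f ->
  rint mu f = fine (\int[mu]_(z in (D : set (borel R n))) (f z)%:E)%E.
Proof.
move=> mD muD /continuous_borel_real mf; congr fine.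
exact: integral_full_measure.
Qed.

(** [pushf] is a bare set function; packing [s] as a measurable map identifies it with
    [distribution]. The change of variables is then applied to the positive and negative parts. *)
Lemma rint_pushf n m (mu : probability (borel R n) R) (s : 'cV[R]_n -> 'cV[R]_m)
    (f : 'cV[R]_m -> R) :
  measurable_fun [set: borel R n] (s : borel R n -> borel R m) -> continuous f ->
  rint (pushf (mu : set (borel R n) -> \bar R) s) f = rint mu (f \o s).
Proof.
move=> ms /continuous_borel_real /measurable_EFinP mf; rewrite /rint; congr fine.
pose s' : {mfun borel R n >-> borel R m} :=
  HB.pack (s : borel R n -> borel R m) (isMeasurableFun.Build _ _ _ _ _ ms).
transitivity (\int[distribution mu s']_y (f y)%:E)%E; first by [].
have pos (h : borel R m -> \bar R) : measurable_fun setT h -> (forall y, 0 <= h y)%E ->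
    (\int[distribution mu s']_y h y = \int[mu]_x h (s x))%E.
  move=> mh h0; transitivity (\int[mu]_(x in s' @^-1` setT) (h \o s') x)%E.
    by apply: ge0_integral_pushforward => //; exact: measurable_funP.
  by rewrite preimage_setT.
rewrite [LHS]integralE [RHS]integralE; congr (_ - _)%E.
  rewrite [LHS](pos (EFin \o f)^\+%E (measurable_funepos mf) (@funepos_ge0 _ _ _)).
  by apply: eq_integral => x _; rewrite !funeposE.
rewrite [LHS](pos (EFin \o f)^\-%E (measurable_funeneg mf) (@funeneg_ge0 _ _ _)).
  by apply: eq_integral => x _; rewrite !funenegE.
Qed.

End BorelFunctions.

(** * A register machine built from attention layers and ReLU networks *)

Section RegisterMachine.
Context {R : realType}.
Variables d d' : nat.
Hypothesis d'_gt0 : (0 < d')%N.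

Local Notation prob := (probability (borel R d) R).
Local Notation D := (d + (d' + (1 + 1)))%N.

Definition within_budget (din : nat) (th : att_param R din) : Prop :=
  (din <= d + 3 * d')%N /\ dhead th = 1%N /\ kdim th = 1%N /\ (nheads th <= d')%N.

(** Without heads attention is the identity; this fills the attention slot of a layer in which only
    the MLP acts. *)
Definition skip_attention n : att_param R n :=
  @AttParam R n 0 1 1 (fun=> 0) (fun=> 0) (fun=> 0) (fun=> 0).

(* With zero query and key matrices the softmax weights are uniform, so the head
   adds the mean of coordinate [j] over the context to coordinate [j]. *)
Definition mean_attention n (j : 'I_n) : att_param R n :=
  @AttParam R n 1 1 1 (fun=> delta_mx j 0) (fun=> 0) (fun=> 0) (fun=> delta_mx 0 j).

Lemma skip_attentionE n (m : meas R n) x : attention (skip_attention n) m x = x.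
Proof. by rewrite /attention /= big_ord0 addr0. Qed.

Lemma mean_attentionE n (j : 'I_n) (mu : prob) (s : 'cV[R]_d -> 'cV[R]_n) x :
  measurable_fun [set: borel R d] (s : borel R d -> borel R n) ->
  attention (mean_attention j) (pushf (mu : set (borel R d) -> \bar R) s) x =
  x + rint mu (fun y => s y j 0) *: delta_mx j 0.
Proof.
move=> ms; rewrite /attention /= big_ord1; congr (_ + _).
have E y : expR ((Num.sqrt 1)^-1 *
    dotv ((0 : 'M[R]_(1, n)) *m x) ((0 : 'M[R]_(1, n)) *m y)) = 1.
  by rewrite /dotv big_ord1 mul0mx mxE mul0r mulr0 expR0.
have -> : (fun y : 'cV[R]_n => expR ((Num.sqrt 1)^-1 *
    dotv ((0 : 'M[R]_(1, n)) *m x) ((0 : 'M[R]_(1, n)) *m y))) = fun=> 1.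
  by apply/funext => y; exact: E.
(* The scores are constantly 1, so the normaliser is the total mass 1 of [mu]. *)
rewrite rint_pushf//; last exact: cst_continuous.
have -> : rint mu ((fun=> 1) \o s) = 1.
  rewrite /rint [X in fine X](_ : _ = \int[mu]_y cst 1 y)%E; last by [].
  rewrite integral_cst// [X in (_ * X)%E](_ : _ = 1%E) ?mule1//.
  exact: probability_setT.
rewrite -mul_mx_scalar; congr (_ *m _); apply/colP => i.
rewrite !mxE ord1 eqxx mulr1n.
rewrite -(@rint_pushf _ _ _ mu s (fun y => y j 0))//; last exact: coord_continuous.
congr rint; apply/funext => y.
by rewrite E divr1 scale1r -rowE mxE.
Qed.

(* Continuation-passing style: any admissible network reading the state [st]
   can be prefixed by layers that compute [st]. *)
Definition realizable n (st : prob -> 'cV[R]_d -> 'cV[R]_n) : Prop :=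
  (forall mu, measurable_fun [set: borel R d] (st mu : borel R d -> borel R n)) /\
  forall rest : tnet R n d', tnet_all within_budget rest ->
  exists2 N : tnet R d d', tnet_all within_budget N &
    forall (mu : prob) x, tnet_eval N (mu : set (borel R d) -> \bar R) x =
      tnet_eval rest (pushf (mu : set (borel R d) -> \bar R) (st mu)) (st mu x).

Lemma realizable_mlp n (f : 'cV[R]_d -> 'cV[R]_n) :
  is_mlp f -> realizable (fun=> f).
Proof.
move=> fP; split=> [mu|rest restP].
  by apply: continuous_borel; exact: mlp_continuous.
have [F Ff] := fP; exists (NetCons (skip_attention d) F rest).
  by split=> //; split; [exact: leq_addr|].
move=> mu x /=; rewrite /icomp /mlp_ic.
have -> : (fun y => mlp_eval F (attention (skip_attention d)
    (mu : set (borel R d) -> \bar R) y)) = f.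
  by apply/funext => y; rewrite skip_attentionE Ff.
by rewrite skip_attentionE Ff.
Qed.

Lemma realizable_mean n m (j : 'I_n) st (f : 'cV[R]_n -> 'cV[R]_m) :
  (n <= d + 3 * d')%N -> realizable st -> is_mlp f ->
  realizable (fun mu x => f (st mu x + rint mu (fun y => st mu y j 0) *: delta_mx j 0)).
Proof.
move=> nd [mst stP] fP; split=> [mu|rest restP].
  (* For a fixed [mu] the mean is a constant vector, so the layer is a translation followed by
     [f]. *)
  have tP (v : 'cV[R]_n) : is_mlp (fun z : 'cV[R]_n => z + v).
    by apply: eq_is_mlp (is_mlp_affine 1%:M v) => z; rewrite mul1mx.
  have mf := continuous_borel (mlp_continuous
    (is_mlp_comp (tP (rint mu (fun y => st mu y j 0) *: delta_mx j 0)) fP)).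
  exact: (measurableT_comp mf (mst mu)).
have [F Ff] := fP.
have [|N NP NE] := stP (NetCons (mean_attention j) F rest); first by [].
exists N => // mu x; rewrite NE.
pose mu' := pushf (mu : set (borel R d) -> \bar R) (st mu).
pose att z := mlp_eval F (attention (mean_attention j) mu' z).
transitivity (tnet_eval rest (pushf mu' att) (att (st mu x))); first by [].
have -> : att = fun z => f (z + rint mu (fun y => st mu y j 0) *: delta_mx j 0).
  by apply/funext => z; rewrite /att Ff /mu' mean_attentionE.
by [].
Qed.

(** The token, the [d'] output accumulators, a running minimum [p] and a slot [u] for means. The
    width [d + d' + 2] fits into [d + 3 * d'] as soon as [d' >= 1]. *)
Definition state (x : 'cV[R]_d) (s : 'cV[R]_d') (p u : R) : 'cV[R]_D :=
  col_mx x (col_mx s (col_mx p%:M u%:M)).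
Definition idx_p : 'I_D := rshift d (rshift d' (lshift 1 0)).
Definition idx_u : 'I_D := rshift d (rshift d' (rshift 1 0)).

Lemma state_x x s p u : usubmx (state x s p u) = x.
Proof. exact: col_mxKu. Qed.

Lemma state_s x s p u : usubmx (dsubmx (state x s p u)) = s.
Proof. by rewrite col_mxKd col_mxKu. Qed.

Lemma state_p x s p u : state x s p u idx_p 0 = p.
Proof. by rewrite !col_mxEd col_mxEu mxE eqxx mulr1n. Qed.

Lemma state_u x s p u : state x s p u idx_u 0 = u.
Proof. by rewrite !col_mxEd mxE eqxx mulr1n. Qed.

Lemma state_addu x s p u c : state x s p u + c *: delta_mx idx_u 0 = state x s p (u + c).
Proof.
have -> : c *: delta_mx idx_u 0 = state 0 0 0 c.
  apply/colP => i; rewrite mxE mxE eqxx andbT /idx_u.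
  case: (split_ordP i) => {}i ->; first by rewrite eq_lrshift mulr0 col_mxEu mxE.
  rewrite eq_rshift col_mxEd.
  case: (split_ordP i) => {}i ->; first by rewrite eq_lrshift mulr0 col_mxEu mxE.
  rewrite eq_rshift col_mxEd.
  case: (split_ordP i) => {}i ->; first by rewrite eq_lrshift mulr0 col_mxEu mxE mul0rn.
  by rewrite eq_rshift col_mxEd !ord1 eqxx mulr1 mxE mulr1n.
by rewrite /state !add_col_mx (raddf0 (@scalar_mx R 1)) !addr0 (raddfD (@scalar_mx R 1)).
Qed.

Lemma is_mlp_state n (fx : 'cV[R]_n -> 'cV[R]_d) fs fp fu :
  is_mlp fx -> is_mlp fs -> is_smlp fp -> is_smlp fu ->
  is_mlp (fun z => state (fx z) (fs z) (fp z) (fu z)).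
Proof. by move=> ? ? ? ?; do 3![apply: is_mlp_col_mx => //]. Qed.

Local Notation T := (prob * 'cV[R]_d)%type.

(* The register [u] is left free: it holds whichever function of [x] the next
   mean is taken of. *)
Definition computable (s : T -> 'cV[R]_d') (p : T -> R) : Prop :=
  forall g, is_smlp g ->
    realizable (fun mu x => state x (s (mu, x)) (p (mu, x)) (g x)).

(** The functions that a single mean makes available; they form the interpolating class of the
    lattice argument. *)
Definition elementary : set (T -> R) :=
  [set f | exists g g' (b : R), [/\ is_smlp g, is_smlp g' &
    f = fun w : T => g w.2 + b * rint (w.1 : set (borel R d) -> \bar R) g']].

(** One layer per elementary function: [u] was preloaded with [g'], the head adds its mean, and the
    MLP assembles [f], updates the registers by [h1] and [h2], and preloads [u] with [g''] for the
    next layer. *)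
Lemma computable_step s p f (h1 : 'cV[R]_D -> 'cV[R]_d') (h2 : 'cV[R]_D -> R) :
  computable s p -> elementary f -> is_mlp h1 -> is_smlp h2 ->
  computable (fun w => h1 (state w.2 (s w) (p w) (f w)))
             (fun w => h2 (state w.2 (s w) (p w) (f w))).
Proof.
move=> spP [g [g' [b [gP g'P ->]]]] h1P h2P g'' g''P.
(* After the head [u] holds [g' x] plus the mean of [g'], hence the subtraction. *)
pose z' (z : 'cV[R]_D) := state (usubmx z) (usubmx (dsubmx z)) (z idx_p 0)
  (g (usubmx z) + b * (z idx_u 0 - g' (usubmx z))).
have z'P : is_mlp z'.
  apply: is_mlp_state.
  - exact: is_mlp_usubmx.
  - exact: (is_mlp_comp is_mlp_dsubmx is_mlp_usubmx).
  - exact: is_smlp_coord.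
  - apply: is_smlpD; first exact: (is_smlp_comp is_mlp_usubmx gP).
    apply: is_smlpZ; apply: is_smlpB; first exact: is_smlp_coord.
    exact: (is_smlp_comp is_mlp_usubmx g'P).
have fP : is_mlp (fun z => state (usubmx z) (h1 (z' z)) (h2 (z' z)) (g'' (usubmx z))).
  apply: is_mlp_state.
  - exact: is_mlp_usubmx.
  - exact: (is_mlp_comp z'P h1P).
  - exact: (is_smlp_comp z'P h2P).
  - exact: (is_smlp_comp is_mlp_usubmx g''P).
have Dd : (D <= d + 3 * d')%N by rewrite leq_add2l mulSn leq_add2l; lia.
have := realizable_mean idx_u Dd (spP g' g'P) fP.
congr realizable; apply/funext => mu; apply/funext => x /=.
have -> : (fun y => state y (s (mu, y)) (p (mu, y)) (g' y) idx_u 0) = g'.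
  by apply/funext => y; rewrite state_u.
rewrite state_addu /z' state_x state_s state_p state_u.
by rewrite [g' x + _]addrC addrK.
Qed.

Definition set_coord (v : 'cV[R]_d') i c : 'cV[R]_d' := \col_k if k == i then c else v k 0.

Lemma is_mlp_set_coord n (f : 'cV[R]_n -> 'cV[R]_d') i g :
  is_mlp f -> is_smlp g -> is_mlp (fun z => set_coord (f z) i (g z)).
Proof.
move=> fP gP; apply: is_mlp_coord => k; have [->|ki] := eqVneq k i.
  by apply: eq_is_smlp gP => z; rewrite mxE eqxx.
by apply: eq_is_smlp (is_mlp_scoord k fP) => z; rewrite mxE (negbTE ki).
Qed.

(** [f] can be brought into [p] from any state without disturbing the accumulators. *)
Definition min_computable : set (T -> R) :=
  [set f | forall s p, computable s p -> computable s f].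

(** The final content [p'] of the scratch register is a leftover, hence existential. *)
Definition max_computable i : set (T -> R) :=
  [set f | forall s p, computable s p ->
     exists p', computable (fun w => set_coord (s w) i (f w)) p'].

Let is_mlp_s : is_mlp (fun z : 'cV[R]_D => usubmx (dsubmx z)) :=
  is_mlp_comp is_mlp_dsubmx is_mlp_usubmx.

Lemma elementary_cst c : elementary (fun=> c).
Proof.
exists (fun=> c), (fun=> 0), 0; split; [exact: is_smlp_cst..|].
by apply/funext => w; rewrite mul0r addr0.
Qed.

Lemma elementary_affine a c f : elementary f -> elementary (fun w => a + c * f w).
Proof.
move=> [g [g' [b [gP g'P ->]]]].
exists (fun x => a + c * g x), g', (c * b); split=> //.
  by apply: is_smlpD; [exact: is_smlp_cst|exact: is_smlpZ].
by apply/funext => w; rewrite mulrDr mulrA addrA.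
Qed.

Lemma elementary_min_computable : elementary `<=` min_computable.
Proof.
move=> f fP s p spP.
have := computable_step spP fP is_mlp_s (is_smlp_coord idx_u).
congr computable; apply/funext => w; first by rewrite state_s.
by rewrite state_u.
Qed.

Lemma min_computable_min f g : min_computable f -> elementary g ->
  min_computable (fun w => Num.min (f w) (g w)).
Proof.
move=> fP gP s p spP.
have := computable_step (fP _ _ spP) gP is_mlp_s
  (is_smlp_min (is_smlp_coord idx_p) (is_smlp_coord idx_u)).
congr computable; apply/funext => w; first by rewrite state_s.
by rewrite state_p state_u.
Qed.

Lemma min_max_computable i : min_computable `<=` max_computable i.
Proof.
move=> f fP s p spP; exists f.
(* The constant 0 is a dummy: only the register update is wanted. *)
have := computable_step (fP _ _ spP) (elementary_cst 0)
  (is_mlp_set_coord i is_mlp_s (is_smlp_coord idx_p)) (is_smlp_coord idx_p).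
by congr computable; apply/funext => w; rewrite ?state_s state_p.
Qed.

(** Coordinate [i] holds the maximum so far; evaluating [g] in [p] leaves it intact, and a dummy
    step then merges the two. *)
Lemma max_computable_max i f g : max_computable i f -> min_computable g ->
  max_computable i (fun w => Num.max (f w) (g w)).
Proof.
move=> fP gP s p spP; have [p' sp'P] := fP _ _ spP; exists g.
have := computable_step (gP _ _ sp'P) (elementary_cst 0)
  (is_mlp_set_coord i is_mlp_s (is_smlp_max (is_mlp_scoord i is_mlp_s)
    (is_smlp_coord idx_p))) (is_smlp_coord idx_p).
congr computable; apply/funext => w; last by rewrite state_p.
rewrite state_s state_p; apply/colP => k; rewrite !mxE eqxx.
by case: (k == i).
Qed.

Lemma max_computable_network (f : 'I_d' -> T -> R) :
  (forall i, max_computable i (f i)) ->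
  exists2 N : tnet R d d', tnet_all within_budget N &
    forall (mu : prob) x, tnet_eval N (mu : set (borel R d) -> \bar R) x =
      \col_i f i (mu, x).
Proof.
move=> fP.
(* The outputs are filled one coordinate at a time, the others still being 0. *)
have [p spP] : exists p, computable
    (fun w => \col_i if i \in enum 'I_d' then f i w else 0) p.
  elim: (enum 'I_d') => [|i l [p IH]].
    exists (fun=> 0) => g gP.
    have stP : is_mlp (fun x => state x 0 0 (g x)).
      apply: is_mlp_state => //; [exact: is_mlp_id| |exact: is_smlp_cst].
      by apply: eq_is_mlp (is_mlp_linear 0) => x; rewrite mul0mx.
    have := realizable_mlp stP; congr realizable.
    apply/funext => mu; apply/funext => x; congr state.
    by apply/colP => i; rewrite !mxE.
  have [p' sp'P] := fP i _ _ IH; exists p'; move: sp'P.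
  congr computable; apply/funext => w; apply/colP => k; rewrite !mxE in_cons.
  by case: eqVneq => [->|].
have [_ rP] := spP _ (is_smlp_cst 0).
have [F FE] := is_mlp_s.
have [|N NP NE] := rP (NetLast (skip_attention D) F).
  by split=> //=; rewrite leq_add2l mulSn leq_add2l; lia.
exists N => // mu x; rewrite NE /= /icomp /mlp_ic skip_attentionE FE state_s.
by apply/colP => i; rewrite !mxE mem_enum.
Qed.

End RegisterMachine.

(** * Limits along ultrafilters and Riemann sums *)

Lemma cvg_ler (R : realType) (I : Type) (U : set_system I) {PU : ProperFilter U}
    (f g : I -> R) (l l' : R) :
  f @ U --> l -> g @ U --> l' -> (forall a, f a <= g a) -> l <= l'.
Proof.
move=> /cvgrPdist_lt fl /cvgrPdist_lt gl fg; rewrite leNgt; apply/negP => ll.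
have e0 : 0 < (l - l') / 2 by lra.
have [a []] := filter_ex (filterI (fl _ e0) (gl _ e0)).
rewrite /= !ltr_norml => /andP[? ?] /andP[? ?].
by have := fg a; lra.
Qed.

Lemma cvg_eqr (R : realType) (I : Type) (U : set_system I) {PU : ProperFilter U}
    (f : I -> R) (l l' : R) : f @ U --> l -> f @ U --> l' -> l = l'.
Proof.
by move=> fl fl'; apply/eqP; rewrite eq_le (cvg_ler fl fl')// (cvg_ler fl' fl).
Qed.

(** An ultrafilter converges to each of its cluster points. *)
Lemma ultra_compact_cvg (I : Type) (X : topologicalType) (U : set_system I) (K : set X)
    (h : I -> X) :
  UltraFilter U -> compact K -> U (h @^-1` K) -> exists2 l, K l & h @ U --> l.
Proof.
move=> UU cK UK; have [l [Kl hl]] := cK (h @ U) _ UK.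
exists l => // A Al; rewrite /nbhs /=.
have [//|UnA] := in_ultra_setVsetC (h @^-1` A) UU.
by have [x [nAx Ax]] := hl (~` A) A UnA Al.
Qed.

(** A free ultrafilter on [nat] replaces the extraction of subsequences. *)
Lemma eventually_ultra : exists2 V : set_system nat, UltraFilter V & \oo `<=` V.
Proof. by have [V [VU Voo]] := ultraFilterLemma eventually_filter; exists V. Qed.

(* Both Lebesgue measure and the measures of the ultrafilter are compared with a
   Riemann sum over the finite partition given by the fibers of [kappa]. *)
Lemma integral_riemann_sum (R : realType) (disp : measure_display)
    (S : measurableType disp) (P : probability S R) (D : set S) (h : S -> R)
    (n : nat) (kappa : S -> nat) (c : nat -> R) (e : R) :
  measurable D -> P D = 1%E -> P.-integrable D (EFin \o h) ->
  (forall i, measurable (D `&` kappa @^-1` [set i])) ->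
  (forall x, D x -> (kappa x < n)%N) ->
  (forall x, D x -> `|h x - c (kappa x)| <= e) ->
  `|\int[P]_(x in D) h x -
    \sum_(i < n) c i * fine (P (D `&` kappa @^-1` [set (i : nat)]))| <= e.
Proof.
move=> mD PD ih mE kn he.
pose E i := D `&` kappa @^-1` [set i].
(* On [D] this step function equals [c (kappa x)], and its integral is the Riemann sum. *)
pose s x := \sum_(i < n) c i * \1_(E i) x.
have iE i : P.-integrable D (fun x => (c i * \1_(E i) x)%:E).
  under eq_fun do rewrite EFinM.
  apply: integrableZl => //; apply: integrableS (integrable_indic P (mE i)) => //.
have is_ : P.-integrable D (EFin \o s).
  rewrite (_ : EFin \o s = fun x => \sum_(i < n) (c i * \1_(E i) x)%:E); last first.
    by apply/funext => x; rewrite /s /= sumEFin.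
  exact: integrable_sum.
have -> : \sum_(i < n) c i * fine (P (E i)) = \int[P]_(x in D) s x.
  rewrite /Rintegral.
  under eq_integral do rewrite /s -sumEFin.
  rewrite integral_sum // -sum_fine; last by move=> i _; exact: integrable_fin_num.
  apply: eq_bigr => i _.
  under eq_integral do rewrite EFinM.
  rewrite integralZl//; last first.
    by apply: integrableS (integrable_indic P (mE i)).
  rewrite (integral_indic P mD (mE i)) setIAC setIid.
  by rewrite fineM// fin_num_measure.
rewrite -RintegralB//; apply: le_trans (le_normr_Rintegral _ _) _ => //.
  by apply: (integrableB mD ih is_).
have -> : e = \int[P]_(x in D) e.
  by rewrite Rintegral_cst// [X in fine X](_ : _ = 1%E) ?mulr1.
apply: le_Rintegral => //.
- exact: (integrable_abse (integrableB mD ih is_)).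
- exact: finite_measure_integrable_cst.
move=> x Dx; rewrite (_ : s x = c (kappa x)); first exact: he.
rewrite /s (bigD1 (Ordinal (kn x Dx)))//= big1 ?addr0.
  by rewrite indicE mem_set// mulr1.
move=> i ik; rewrite indicE memNset ?mulr0// => -[_ /= ki].
by move/eqP : ik; apply; apply: val_inj.
Qed.

(** * Coding points by rational half-spaces *)

Section BinaryCode.
Context {R : realType} {d : nat}.

Definition halfspace (k : nat) : set 'cV[R]_d :=
  match unpickle k : option ('I_d * rat) with
  | Some (j, q) => [set y | y j 0 < ratr q]
  | None => set0
  end.

Definition bit k y : bool := `[< halfspace k y >].

(** The newest bit is the least significant: code [i] splits into [2i] and [2i + 1] at the next
    level, so refinement preserves the order of the cells. *)
Fixpoint code (k : nat) (y : 'cV[R]_d) : nat :=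
  if k is k'.+1 then (bit k' y + (code k' y).*2)%N else 0.

Lemma code_half k y : ((code k.+1 y)./2 = code k y)%N.
Proof. by rewrite /= half_bit_double. Qed.

Lemma code_lt k y : (code k y < 2 ^ k)%N.
Proof.
elim: k => //= k IH; rewrite expnS mul2n.
by case: (bit k y); lia.
Qed.

Lemma code_bit k n y y' : code k y = code k y' -> (n < k)%N -> bit n y = bit n y'.
Proof.
elim: k => // k IH E; rewrite ltnS leq_eqVlt => /predU1P[->|nk].
  move: E => /(congr1 odd) /=.
  by rewrite !oddD !odd_double !addbF !oddb.
by apply: IH nk; rewrite -(code_half k y) -(code_half k y') E.
Qed.

Lemma measurable_code k (A : set nat) : measurable (code k @^-1` A : set (borel R d)).
Proof.
elim: k A => [|k IH] A.
  have [A0|nA0] := pselect (A 0%N).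
    have -> : code 0 @^-1` A = setT by apply/seteqP; split.
    exact: (@measurableT _ (borel R d)).
  have -> : code 0 @^-1` A = set0 by apply/seteqP; split.
  exact: (@measurable0 _ (borel R d)).
have mB : measurable (halfspace k : set (borel R d)).
  rewrite /halfspace; case: unpickle => [[j q]|]; last exact: (@measurable0 _ (borel R d)).
  apply: open_borel.
  apply: (@open_comp _ _ (fun y : 'cV[R]_d => y j 0) [set t | t < ratr q]).
    by move=> y _; exact: coord_continuous.
  exact: open_lt.
rewrite (_ : code k.+1 @^-1` A =
    (halfspace k `&` code k @^-1` [set n | A (1 + n.*2)%N]) `|`
    (~` halfspace k `&` code k @^-1` [set n | A (n.*2)])).
  by apply: (@measurableU _ (borel R d)); apply: (@measurableI _ (borel R d)) => //;
    exact: measurableC.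
apply/seteqP; split=> y /=; rewrite /bit; case: asboolP => h /=; rewrite ?add0n; tauto.
Qed.

(** A rational lies strictly between two differing coordinates, and strictness on both sides makes
    the bit locally constant at both points. *)
Lemma code_separates (p z : 'cV[R]_d) : p != z ->
  exists n, exists b, nbhs p [set y | bit n y = b] /\ nbhs z [set y | bit n y = ~~ b].
Proof.
have lt_case (u v : 'cV[R]_d) j : u j 0 < v j 0 -> exists n,
    nbhs u [set y | bit n y = true] /\ nbhs v [set y | bit n y = false].
  move=> uv; have [q] := rat_in_itvoo uv; rewrite in_itv /= => /andP[uq qv].
  have hE y : bit (pickle (j, q)) y = (y j 0 < ratr q).
    by rewrite /bit /halfspace pickleK; apply/asboolP/idP.
  exists (pickle (j, q)); split.
    have hn : nbhs u [set y : 'cV[R]_d | y j 0 < ratr q].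
      exact: (@coord_continuous _ _ _ j 0 u _ (lt_nbhsl uq)).
    by apply: (@filterS _ (nbhs u) _ _ _ _ hn) => y /= h; rewrite hE.
  have hn : nbhs v [set y : 'cV[R]_d | ratr q < y j 0].
    exact: (@coord_continuous _ _ _ j 0 v _ (lt_nbhsr qv)).
  apply: (@filterS _ (nbhs v) _ _ _ _ hn) => y /= h.
  by rewrite hE; apply/negbTE; rewrite -leNgt ltW.
move=> pz; have [j] : exists j, p j 0 != z j 0.
  apply/existsP; apply: contraNT pz => /existsPn pz.
  by apply/eqP/colP => j; apply/eqP; have := pz j; rewrite negbK.
rewrite neq_lt => /orP[/lt_case|/lt_case] [n [h1 h2]]; exists n.
  by exists true.
by exists false.
Qed.

(* Compactness replaces the mesh estimate: two sequences with equal codes of growing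
   length cannot converge to different points. *)
Lemma code_osc (M : pseudoMetricType R) (Om : set 'cV[R]_d) (f : 'cV[R]_d -> M) (e : R) :
  compact Om -> {within Om, continuous f} -> 0 < e ->
  exists k, forall y y', Om y -> Om y' -> code k y = code k y' -> ball (f y) e (f y').
Proof.
move=> cOm /subspace_continuousP cf e0; apply/not_existsP => bad.
have /choice[s sP] k : exists yy : 'cV[R]_d * 'cV[R]_d,
    [/\ Om yy.1, Om yy.2, code k yy.1 = code k yy.2 & ~ ball (f yy.1) e (f yy.2)].
  apply: contrapT => /forallNP nk; apply: (bad k) => y y' Oy Oy' E.
  by apply: contrapT => nb; apply: (nk (y, y')).
have [V VU Voo] := eventually_ultra.
have [p Op sp] : exists2 p, Om p & (fun k => (s k).1) @ V --> p.
  by apply: ultra_compact_cvg => //; apply: filterE => k; have [] := sP k.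
have [z Oz sz] : exists2 z, Om z & (fun k => (s k).2) @ V --> z.
  by apply: ultra_compact_cvg => //; apply: filterE => k; have [] := sP k.
(* Distinct limits would be separated by some bit [n], on which the two sequences agree once
   [k > n]. *)
have [pz|pz] := eqVneq p z; last first.
  have [n [b [np nz]]] := code_separates pz.
  have Vn : V [set k | (n < k)%N] by apply: Voo; exists n.+1.
  have Vp : V [set k | bit n (s k).1 = b] by exact: (sp _ np).
  have Vz : V [set k | bit n (s k).2 = ~~ b] by exact: (sz _ nz).
  have [k [[/= h1 h2] nk]] := filter_ex (filterI (filterI Vp Vz) Vn).
  have [_ _ E _] := sP k.
  by move: h2; rewrite -(code_bit E nk) h1 => /eqP; rewrite -addbT; case: (b).
have cvgf (t : nat -> 'cV[R]_d) : (forall k, Om (t k)) -> t @ V --> p ->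
    V [set k | ball (f p) (e / 2) (f (t k))].
  move=> Ot tp; have e2 : 0 < e / 2 by rewrite divr_gt0.
  have h : nbhs p [set y | Om y -> ball (f p) (e / 2) (f y)].
    exact: (cf p Op _ (nbhsx_ballx (f p) _ e2)).
  have Vh : V [set k | Om (t k) -> ball (f p) (e / 2) (f (t k))] by exact: (tp _ h).
  by apply: filterS Vh => k; apply.
have h1 : V [set k | ball (f p) (e / 2) (f (s k).1)].
  by apply: (cvgf (fun k => (s k).1)) => // k; have [] := sP k.
have h2 : V [set k | ball (f p) (e / 2) (f (s k).2)].
  by apply: (cvgf (fun k => (s k).2)); rewrite ?pz// => k; have [] := sP k.
have [k [/= b1 b2]] := filter_ex (filterI h1 h2).
by have [_ _ _] := sP k; apply; exact: ball_splitr b1 b2.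
Qed.

End BinaryCode.

(** * The limit measure built from limit masses of cells *)

Section LimitMeasure.
Context {R : realType} {d : nat} (Om : set 'cV[R]_d) (cOm : compact Om).
Context (I : Type) (U : set_system I) (UU : UltraFilter U).
Local Notation prob := (probability (borel R d) R).
Context (nu : I -> prob) (nuOm : U [set a | nu a Om = 1%E]).

Definition cell k i : set (borel R d) := Om `&` code k @^-1` [set i].
(** The limit masses of these initial segments are the division points of [[0, 1[]. *)
Definition cells_below k i : set (borel R d) := Om `&` code k @^-1` [set n | (n < i)%N].

Let mOm : measurable (Om : set (borel R d)) := compact_borel cOm.

Lemma measurable_cell k i : measurable (cell k i).
Proof. by apply: measurableI => //; exact: measurable_code. Qed.

Lemma measurable_cells_below k i : measurable (cells_below k i).
Proof. by apply: measurableI => //; exact: measurable_code. Qed.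

Lemma fine_cell (mu : prob) k i :
  fine (mu (cell k i)) = fine (mu (cells_below k i.+1)) - fine (mu (cells_below k i)).
Proof.
have -> : cells_below k i.+1 = cells_below k i `|` cell k i.
  apply/seteqP; split=> y /=.
    by move=> [Oy /=]; rewrite ltnS leq_eqVlt => /predU1P[|]; [right|left].
  by move=> [[Oy /= yi]|[Oy /= yi]]; split=> //=; rewrite ?yi//; exact: ltnW.
rewrite measureU; [|exact: measurable_cells_below|exact: measurable_cell|].
  rewrite fineD; last 2 first.
  - by apply: fin_num_measure; exact: measurable_cells_below.
  - by apply: fin_num_measure; exact: measurable_cell.
  by rewrite addrAC subrr add0r.
by apply/seteqP; split=> // y [[_ /= +] [_ /= yi]]; rewrite yi ltnn.
Qed.

Lemma limit_cumulative : exists G : nat -> nat -> R,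
  forall k i, (fun a => fine (nu a (cells_below k i))) @ U --> G k i.
Proof.
suff /choice[G GP] : forall ki : nat * nat, exists l : R,
    (fun a => fine (nu a (cells_below ki.1 ki.2))) @ U --> l.
  by exists (fun k i => G (k, i)) => k i; exact: (GP (k, i)).
move=> [k i] /=.
have [|l _ hl] := @ultra_compact_cvg I R U `[0, 1]%classic
    (fun a => fine (nu a (cells_below k i))) UU (@segment_compact R 0 1).
  apply: filterE => a /=; rewrite in_itv /= fine_ge0//=.
  rewrite -lee_fin fineK; first by apply: probability_le1; exact: measurable_cells_below.
  by apply: fin_num_measure; exact: measurable_cells_below.
by exists l.
Qed.

Section WithCumulative.
Context (G : nat -> nat -> R)
  (GU : forall k i, (fun a => fine (nu a (cells_below k i))) @ U --> G k i).

Lemma cumulative0 k : G k 0 = 0.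
Proof.
apply: (cvg_eqr (@GU k 0)).
rewrite (_ : (fun a => _) = cst 0); first exact: cvg_cst.
apply/funext => a; rewrite (_ : cells_below k 0 = set0) ?measure0//.
by apply/seteqP; split=> // y [].
Qed.

(** All codes of level [k] are below [2 ^ k], so this segment is [Om], of mass 1 for [U]-almost all
    measures. *)
Lemma cumulative1 k : G k (2 ^ k)%N = 1.
Proof.
apply: (cvg_eqr (@GU k _)).
apply: cvg_near_cst; apply: filterS nuOm => a /= h.
rewrite (_ : cells_below k (2 ^ k) = Om) ?h//.
by apply/seteqP; split=> [y []//|y Oy]; split=> //=; exact: code_lt.
Qed.

Lemma cumulative_le k i j : (i <= j)%N -> G k i <= G k j.
Proof.
move=> ij; apply: (cvg_ler (@GU k i) (@GU k j)) => a.
apply: fine_le; [by apply: fin_num_measure; exact: measurable_cells_below..|].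
apply: le_measure; [by rewrite inE; exact: measurable_cells_below..|].
by move=> y [Oy /= yi]; split=> //=; exact: leq_trans ij.
Qed.

(** A code of level [k.+1] is below [2i] exactly when its half is below [i]; hence the subdivisions
    refine one another. *)
Lemma cumulative_double k i : G k.+1 i.*2 = G k i.
Proof.
apply: (cvg_eqr (@GU k.+1 _)).
rewrite (_ : (fun a => _) = fun a => fine (nu a (cells_below k i))); first exact: GU.
apply/funext => a; congr (fine (nu a _)).
by apply/seteqP; split=> y [Oy /= h]; split=> //=; move: h; case: (bit k y); lia.
Qed.

Lemma cvg_cell k i : (fun a => fine (nu a (cell k i))) @ U --> G k i.+1 - G k i.
Proof.
rewrite (_ : (fun a => _) = fun a => fine (nu a (cells_below k i.+1)) -
  fine (nu a (cells_below k i))); last by apply/funext => a; exact: fine_cell.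
by apply: cvgB; exact: GU.
Qed.

(** The interval assigned to [cell k i]; its length is the limit mass of that cell. *)
Definition in_step k i t := G k i <= t < G k i.+1.

Lemma in_step_ex k t : 0 <= t < 1 -> exists2 i, (i < 2 ^ k)%N & in_step k i t.
Proof.
move=> /andP[t0 t1]; have ex : exists i, t < G k i by exists (2 ^ k)%N; rewrite cumulative1.
(* The step is the predecessor of the least index at which [G k] exceeds [t]. *)
case: (ex_minnP ex) => -[|i] ti imin.
  by move: ti; rewrite cumulative0 ltNge t0.
exists i; first by apply: imin; rewrite cumulative1.
rewrite /in_step ti andbT leNgt; apply/negP => /imin; by rewrite ltnn.
Qed.

Lemma in_step_inj k i j t : in_step k i t -> in_step k j t -> i = j.
Proof.
wlog ij : i j / (i < j)%N.
  move=> H hi hj; have [ij|ij|//] := ltngtP i j; first exact: H.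
  by apply/esym; apply: H.
move=> /andP[_ ti] /andP[tj _]; have := cumulative_le k ij.
by move=> /(lt_le_trans ti) /lt_le_trans /(_ tj); rewrite ltxx.
Qed.

Lemma in_step_half k i t : in_step k.+1 i t -> in_step k i./2 t.
Proof.
move=> /andP[ti it]; rewrite /in_step -(cumulative_double k i./2) -(cumulative_double k i./2.+1); apply/andP; split.
  by apply: le_trans ti; apply: cumulative_le; lia.
by apply: lt_le_trans it _; apply: cumulative_le; lia.
Qed.

Lemma in_step_prefix k l (y : 'cV[R]_d) t : (k <= l)%N -> in_step l (code l y) t -> in_step k (code k y) t.
Proof.
move=> /subnK <-; elim: (l - k)%N => // m IH h; apply: IH.
by rewrite -code_half; exact: in_step_half.
Qed.

(** An empty cell has limit mass 0, hence an empty step. *)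
Lemma in_step_cell k i t : in_step k i t -> cell k i !=set0.
Proof.
move=> /andP[ti it]; apply/set0P/eqP => c0.
have : G k i.+1 - G k i = 0.
  apply: (cvg_eqr (@cvg_cell k i)).
  by rewrite c0; under eq_fun do rewrite measure0; exact: cvg_cst.
by move/eqP; rewrite subr_eq0 => /eqP E; move: it; rewrite E ltNge ti.
Qed.

(** Points chosen in the cells assigned to [t] stay in [cell k i] from level [k] on, because the
    steps are nested. Their limit lies in its closure, though perhaps not in the cell. *)
Lemma limit_point t : 0 <= t < 1 -> exists p, Om p /\
  forall k i, in_step k i t -> closure (cell k i : set 'cV[R]_d) p.
Proof.
move=> t01.
have /choice[y yP] k : exists y : 'cV[R]_d, Om y /\ in_step k (code k y) t.
  have [i _ hi] := in_step_ex k t01; have [y [Oy /= yi]] := in_step_cell hi.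
  by exists y; rewrite yi.
have [V VU Voo] := eventually_ultra.
have [p Op yp] : exists2 p, Om p & y @ V --> p.
  by apply: ultra_compact_cvg => //; apply: filterE => k; have [] := yP k.
exists p; split=> // k i hi B pB.
have VB : V [set l | B (y l)] by exact: (yp _ pB).
have Vk : V [set l | (k <= l)%N] by apply: Voo; exists k.
have [l [Bl kl]] := filter_ex (filterI VB Vk).
have [Oy hy] := yP l; exists (y l); split=> //; split=> //=.
exact: in_step_inj (in_step_prefix kl hy) hi.
Qed.

Let lam : probability _ R := uniform_prob (@ltr01 R).

Lemma uniform_itv (a b : R) : 0 <= a -> a <= b -> b <= 1 ->
  lam `[a, b[%classic = (b - a)%:E.
Proof.
move=> a0 ab b1; rewrite /lam /= /uniform_prob.
rewrite (eq_integral (fun=> 1%E)); last first.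
  move=> t; rewrite inE /= in_itv /= => /andP[? ?].
  by rewrite /uniform_pdf ifT ?subr0 ?invr1//; apply/andP; split; lra.
rewrite integral_cst//= lebesgue_measure_itv/= lte_fin mul1e.
by case: ltP => // ba; congr EFin; lra.
Qed.

Lemma uniform_step k i : (i < 2 ^ k)%N ->
  lam (`[0, 1[%classic `&` [set t | in_step k i t]) = (G k i.+1 - G k i)%:E.
Proof.
move=> ik.
have G0 : 0 <= G k i by rewrite -(cumulative0 k); exact: cumulative_le.
have G1 : G k i.+1 <= 1 by rewrite -(cumulative1 k); exact: cumulative_le.
have -> : `[0, 1[%classic `&` [set t | in_step k i t] = `[G k i, G k i.+1[%classic.
  apply/seteqP; split=> t /=; rewrite !in_itv /=; first by case.
  by move=> h; split=> //; move: h => /andP[? ?]; apply/andP; split; lra.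
by apply: uniform_itv => //; exact: cumulative_le.
Qed.

Lemma measurable_in_step k i : measurable ([set t | in_step k i t] : set (measurableTypeR R)).
Proof.
have -> : [set t | in_step k i t] = `[G k i, G k i.+1[%classic.
  by apply/seteqP; split=> t /=; rewrite in_itv.
exact: measurable_itv.
Qed.

(* The fibers of a selection of [limit_point] over an open set are countable unions
   of steps, because cells whose closure contains a given point shrink to it. *)
Lemma limit_map : exists2 T : R -> 'cV[R]_d,
  measurable_fun setT (T : measurableTypeR R -> borel R d) &
  forall t, Om (T t) /\ (0 <= t < 1 -> forall k i,
    in_step k i t -> closure (cell k i : set 'cV[R]_d) (T t)).
Proof.
have [y0 [Oy0 _]] : exists p, Om p /\
    forall k i, in_step k i 0 -> closure (cell k i : set 'cV[R]_d) p.
  by apply: limit_point; rewrite lexx ltr01.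
have /choice[T TP] t : exists p, [/\ Om p, 0 <= t < 1 -> forall k i,
    in_step k i t -> closure (cell k i : set 'cV[R]_d) p & ~~ (0 <= t < 1) -> p = y0].
  have [/limit_point[p [Op h]]|nt] := boolP (0 <= t < 1); first by exists p.
  by exists y0; split=> // /(negP nt).
exists T; last by move=> t; have [] := TP t.
apply: (@measurability _ _ (measurableTypeR R) (borel R d) setT T (@open 'cV[R]_d)) => //.
move=> _ [W oW <-]; rewrite setTI.
pose step k i := if `[< closure (cell k i : set 'cV[R]_d) `<=` W >]
  then [set t | in_step k i t] else set0.
(* Outside [[0, 1[] the map is constantly [y0]; inside, the steps whose cells have closure in [W]
   suffice. *)
have -> : T @^-1` W = (~` `[0, 1[%classic `&` [set t : R | W y0]) `|`
    (`[0, 1[%classic `&` \bigcup_k \bigcup_i step k i).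
  apply/seteqP; split=> t /=; have [Ot tT ty] := TP t.
    move=> OT; have [t01|t01] := boolP (0 <= t < 1); last first.
      by left; rewrite in_itv /= -(ty t01); split=> //; exact/negP.
    right; split; first by rewrite in_itv.
    have /nbhs_ballP[e /= e0 eO] : nbhs (T t) W by exact: open_nbhs_nbhs.
    have e3 : 0 < e / 3 by rewrite divr_gt0.
    have [|k kP] := @code_osc _ _ _ Om id (e / 3) cOm _ e3.
      by apply: continuous_subspaceT => x; exact: cvg_id.
    have [i _ hi] := in_step_ex k t01.
    exists k => //; exists i => //; rewrite /step; case: asboolP => // nO.
    exfalso; apply: nO => z zc; apply: eO.
    (* [T t] and [z] are each [e / 3]-close to a point of the cell, and these two points share a
       code. *)
    have [y [[Oy /= yi] py]] := tT t01 k i hi _ (nbhsx_ballx _ _ e3).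
    have [y' [[Oy' /= yi'] zy']] := zc _ (nbhsx_ballx _ _ e3).
    have -> : e = e / 3 + e / 3 + e / 3 by field.
    apply: (@ball_triangle _ _ y'); last exact: ball_sym.
    by apply: (ball_triangle py); apply: kP => //; rewrite yi yi'.
  case=> [[/negP + Oy0']|]; first by rewrite in_itv /= => /ty ->.
  rewrite in_itv /= => -[t01 [k _ [i _]]]; rewrite /step; case: asboolP => // cO hi.
  by apply: cO; exact: tT.
have m01 : measurable (`[0, 1[%classic : set (measurableTypeR R)) by exact: measurable_itv.
apply: measurableU; apply: measurableI => //.
- exact: measurableC.
- have [h|h] := pselect (W y0).
    by rewrite (_ : [set _ | _] = setT) //; apply/seteqP; split.
  by rewrite (_ : [set _ | _] = set0) //; apply/seteqP; split.
- apply: bigcupT_measurable => k; apply: bigcupT_measurable => i.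
  by rewrite /step; case: ifP => _ //; exact: measurable_in_step.
Qed.

(** The coefficients and the level depend on [f] and [e] only: one Riemann sum serves [mu] with the
    limit masses and every [rho] with its own, so the limit along [U] can be taken in a finite
    sum. *)
Lemma limit_measure : exists2 mu : prob, mu Om = 1%E &
  forall f : 'cV[R]_d -> R, {within Om, continuous f} ->
  forall e : R, 0 < e -> exists n (k : nat) (c : nat -> R),
   `| fine (\int[mu]_(z in (Om : set (borel R d))) (f z)%:E)%E
      - \sum_(i < n) c i * (G k i.+1 - G k i)| <= e /\
   forall rho : prob, rho Om = 1%E ->
   `| fine (\int[rho]_(z in (Om : set (borel R d))) (f z)%:E)%E
      - \sum_(i < n) c i * fine (rho (cell k i))| <= e.
Proof.
have [T mT TP] := limit_map.
pose T' : {mfun measurableTypeR R >-> borel R d} :=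
  HB.pack (T : measurableTypeR R -> borel R d) (isMeasurableFun.Build _ _ _ _ _ mT).
pose mu : prob := distribution lam T'.
have muOm : mu Om = 1%E.
  transitivity (lam (T @^-1` Om)); first by [].
  rewrite (_ : T @^-1` Om = setT); first exact: probability_setT.
  by apply/seteqP; split=> // t _; have [] := TP t.
exists mu => // f cf e e0.
have e2 : 0 < e / 2 by rewrite divr_gt0.
have [k kP] := code_osc cOm cf e2.
(* A sample point for each cell; empty cells, which carry no mass, get an arbitrary one. *)
have /choice[rep repP] i : exists y : 'cV[R]_d, cell k i !=set0 -> cell k i y.
  by have [[y yi]|n] := pselect (cell k i !=set0); [exists y|exists 0].
exists (2 ^ k)%N, k, (fun i => f (rep i)); split; last first.
  move=> rho rhoOm; apply: (@integral_riemann_sum R _ (borel R d) rho Om f (2 ^ k) (code k) (fun i => f (rep i)) e) => //.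
  - exact: within_continuous_integrable.
  - by move=> i; exact: measurable_cell.
  - by move=> x _; exact: code_lt.
  move=> x Ox; have [|Or /= rx] := repP (code k x); first by exists x.
  have := kP _ _ Ox Or (esym rx); rewrite /ball /= => h.
  by apply: ltW; apply: (lt_trans h); lra.
(* [f] is controlled on [Om] only; its extension by 0 is Borel on the whole space, as the change of
   variables requires. *)
pose F : borel R d -> R := (f : borel R d -> R) \_ Om.
have FE y : Om y -> F y = f y by move=> Oy; rewrite /F patchE mem_set.
have mF : measurable_fun setT F.
  by apply/(measurable_restrictT _ _).1 => //; exact: within_continuous_borel.
have mFT : measurable_fun setT (F \o T : measurableTypeR R -> R).
  exact: (measurableT_comp mF mT).
pose D : set (measurableTypeR R) := `[0, 1[%classic.
have mD : measurable D by exact: measurable_itv.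
have lamD : lam D = 1%E by rewrite /D uniform_itv ?subr0.
have intFT (A : set (measurableTypeR R)) : measurable A ->
    lam.-integrable A (EFin \o (F \o T)).
  move=> mA; apply: measurable_bounded_integrable => //.
  - exact: (le_lt_trans (probability_le1 lam mA)) (ltry _).
  - exact: measurable_funTS.
  - have /compact_bounded[M [Mr Mb]] := continuous_compact cf cOm.
    exists M; split=> // x Mx t _ /=; have [Ot _] := TP t.
    by rewrite FE//; apply: Mb => //; exists (T t).
have -> : fine (\int[mu]_(z in (Om : set (borel R d))) (f z)%:E)%E =
    \int[lam]_(t in D) (F \o T) t.
  congr fine; transitivity (\int[mu]_(z in Om) (F z)%:E)%E.
    by apply: eq_integral => y /set_mem Oy; rewrite FE.
  rewrite -(integral_full_measure mOm muOm mF) -(integral_full_measure mD lamD mFT).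
  transitivity (\int[lam]_(x in T' @^-1` setT) ((EFin \o F) \o T') x)%E.
    apply: integral_pushforward => //; first exact/measurable_EFinP.
    by rewrite preimage_setT; exact: intFT.
  by rewrite preimage_setT.
have /choice[w wP] t : exists i, 0 <= t < 1 -> (i < 2 ^ k)%N /\ in_step k i t.
  have [/(in_step_ex k)[i ? ?]|/negP nt] := boolP (0 <= t < 1); first by exists i.
  by exists 0%N.
have wE i : D `&` w @^-1` [set i] = D `&` [set t | in_step k i t].
  apply/seteqP; split=> t [Dt /= h]; split=> //=; move: Dt; rewrite /D /= in_itv /=.
    by move=> /wP[_]; rewrite h.
  by move=> /wP[_ h']; exact: in_step_inj h' h.
have -> : \sum_(i < 2 ^ k) f (rep i) * (G k i.+1 - G k i) =
    \sum_(i < 2 ^ k) f (rep i) * fine (lam (D `&` w @^-1` [set (i : nat)])).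
  by apply: eq_bigr => i _; rewrite wE uniform_step.
apply: (@integral_riemann_sum R _ _ lam D (F \o T) (2 ^ k) w (fun i => f (rep i)) e) => //.
- exact: intFT.
- by move=> i; rewrite wE; apply: measurableI => //; exact: measurable_in_step.
- by move=> t; rewrite /D /= in_itv /= => /wP[].
move=> t; rewrite /D /= in_itv /= => t01; have [_ hw] := wP t t01.
have [OT Tc] := TP t; rewrite FE//.
have /subspace_continuousP/(_ _ OT) cfT := cf.
have h : nbhs (T t) [set y | Om y -> ball (f (T t)) (e / 2) (f y)].
  exact: (cfT _ (nbhsx_ballx _ _ e2)).
(* [T t] is only in the closure of its cell, so [f] is compared first with a nearby point [y] of the
   cell, then with the sample point: twice [e / 2]. *)
have [y [[Oy /= yi] yT]] := Tc t01 _ _ hw _ h.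
have [|Or /= rx] := repP (w t); first exact: in_step_cell hw.
have := yT Oy; have := kP _ _ Oy Or (etrans yi (esym rx)); rewrite /ball /= => h1 h2.
have -> : f (T t) - f (rep (w t)) = (f (T t) - f y) + (f y - f (rep (w t))) by lra.
by apply: le_trans (ler_normD _ _) _; lra.
Qed.

End WithCumulative.
End LimitMeasure.

(** * Compactness of the space of probabilities and density of ReLU functions *)

Section Approximation.
Context {R : realType}.

Lemma enorm_le_coord n (v : 'cV[R]_n) (e : R) : (forall i, `|v i 0| <= e) -> 0 <= e ->
  enorm v <= n.+1%:R * e.
Proof.
move=> ve e0; have ne0 : 0 <= n.+1%:R * e by rewrite mulr_ge0.
rewrite /enorm -[leRHS]ger0_norm// -sqrtr_sqr ler_sqrt ?sqr_ge0//.
apply: (@le_trans _ _ (\sum_(i < n) e ^+ 2)).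
  apply: ler_sum => i _; rewrite -expr2 -[v i 0 ^+ 2]ger0_norm ?sqr_ge0// normrX.
  by rewrite lerXn2r ?nnegrE.
rewrite sumr_const card_ord -[_ *+ _]mulr_natl exprMn ler_wpM2r ?sqr_ge0//.
by rewrite -natrX ler_nat; nia.
Qed.

Lemma coord_le_enorm n (v : 'cV[R]_n) i : `|v i 0| <= enorm v.
Proof.
rewrite -sqrtr_sqr ler_sqrt; last by apply: sumr_ge0 => j _; rewrite -expr2 sqr_ge0.
rewrite /dotv (bigD1 i)//= -expr2 lerDl.
by apply: sumr_ge0 => j _; rewrite -expr2 sqr_ge0.
Qed.

Lemma probability_compact d (Om : set 'cV[R]_d) (I : Type) (U : set_system I)
    (nu : I -> probability (borel R d) R) :
  compact Om -> UltraFilter U -> U [set a | nu a Om = 1%E] ->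
  exists2 mu : probability (borel R d) R, mu Om = 1%E &
    forall f : 'cV[R]_d -> R, {within Om, continuous f} ->
      (fun a => fine (\int[nu a]_(z in (Om : set (borel R d))) (f z)%:E)%E) @ U -->
      fine (\int[mu]_(z in (Om : set (borel R d))) (f z)%:E)%E.
Proof.
move=> cOm UU nuOm; have [G GU] := limit_cumulative cOm UU nu.
have [mu muOm H] := limit_measure cOm UU nuOm GU; exists mu => // f cf.
apply/cvgrPdist_lt => e e0; have e4 : 0 < e / 4 by rewrite divr_gt0.
have [n [k [c [h1 h2]]]] := H f cf _ e4.
have : (fun a => \sum_(i < n) c i * fine (nu a (cell Om k i))) @ U -->
    \sum_(i < n) c i * (G k i.+1 - G k i).
  apply: cvg_sumr => i _; apply: cvgM; first exact: cvg_cst.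
  exact: cvg_cell.
move=> /cvgrPdist_lt/(_ _ e4) h3.
apply: filterS2 h3 nuOm => a /= h3 /h2 h4.
set A := fine _ in h1 *; set B := fine _ in h4 *.
set S1 := \sum_(i < n) _ in h1 h3; set S2 := \sum_(i < n) _ in h3 h4.
(* Each integral is within [e / 4] of its Riemann sum, and the two sums differ by less than
   [e / 4]. *)
rewrite (_ : A - B = (A - S1) + (S1 - S2) + (S2 - B)); last by lra.
apply: le_lt_trans (ler_normD _ _) _; rewrite (distrC S2).
apply: (@le_lt_trans _ _ (`|A - S1| + `|S1 - S2| + `|B - S2|)); last by lra.
by rewrite lerD2r ler_normD.
Qed.

(** The lattice theorem with its three classes equal: ReLU functions are stable under minima and
    maxima, and an affine function of one coordinate interpolates two values. *)
Lemma mlp_dense d (Om : set 'cV[R]_d) (f : 'cV[R]_d -> R) (e : R) :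
  compact Om -> Om !=set0 -> {within Om, continuous f} -> 0 < e ->
  exists2 g, is_smlp g & forall x, Om x -> `|g x - f x| < e.
Proof.
move=> cOm Om0 /subspace_continuousP cf.
apply: (@lattice_approximation R _ Om (@is_smlp R d) (@is_smlp R d) (@is_smlp R d)) => //.
- move=> U UU UOm.
  have [p Op Up] := @ultra_compact_cvg _ _ U Om id UU cOm UOm.
  exists p; split=> //; last by move=> g gP; exact: smlp_cvg gP Up.
  move=> A fA; have h : nbhs p [set y | Om y -> A (f y)] by exact: (cf p Op _ fA).
  have Uh : U [set y | Om y -> A (f y)] by exact: (Up _ h).
  have : U [set y | A (f y)] by apply: filterS2 Uh UOm => y; apply.
  by [].
- move=> p q Op Oq; have [->|pq] := eqVneq p q.
    by exists (fun=> f q); split=> //; exact: is_smlp_cst.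
  have [j pj] : exists j, p j 0 != q j 0.
    apply/existsP; apply: contraNT pq => /existsPn pq.
    by apply/eqP/colP => j; apply/eqP; have := pq j; rewrite negbK.
  have qp : q j 0 - p j 0 != 0 by rewrite subr_eq0 eq_sym.
  exists (fun x => f p + (f q - f p) / (q j 0 - p j 0) * (x j 0 - p j 0)); split.
  + apply: is_smlpD; first exact: is_smlp_cst.
    by apply: is_smlpZ; apply: is_smlpB; [exact: is_smlp_coord|exact: is_smlp_cst].
  + by rewrite subrr mulr0 addr0.
  + by field.
- by move=> g h; exact: is_smlp_min.
- by move=> g h; exact: is_smlp_max.
Qed.

Lemma integral_close d (Om : set 'cV[R]_d) (f g : 'cV[R]_d -> R) (e : R)
    (mu : probability (borel R d) R) :
  compact Om -> mu Om = 1%E -> {within Om, continuous f} -> {within Om, continuous g} ->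
  (forall x, Om x -> `|g x - f x| <= e) ->
  `|fine (\int[mu]_(z in (Om : set (borel R d))) (g z)%:E)%E -
    fine (\int[mu]_(z in (Om : set (borel R d))) (f z)%:E)%E| <= e.
Proof.
move=> cOm muOm cf cg fg; have mOm := compact_borel cOm.
have intf := within_continuous_integrable mu cOm cf.
have intg := within_continuous_integrable mu cOm cg.
have intB := integrableB mOm intg intf.
rewrite -[X in `|X|](RintegralB mOm intg intf).
apply: le_trans (le_normr_Rintegral mOm intB) _.
have -> : e = \int[mu]_(x in Om) e.
  by rewrite Rintegral_cst// [X in fine X](_ : _ = 1%E) ?mulr1.
apply: le_Rintegral => //.
- exact: (integrable_abse intB).
- exact: finite_measure_integrable_cst.
Qed.

Lemma eq_integral_of_mlp d (Om : set 'cV[R]_d) (mu nu : probability (borel R d) R) :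
  compact Om -> Om !=set0 -> mu Om = 1%E -> nu Om = 1%E ->
  (forall g, is_smlp g -> rint mu g = rint nu g) ->
  forall f : 'cV[R]_d -> R, {within Om, continuous f} ->
  fine (\int[nu]_(z in (Om : set (borel R d))) (f z)%:E)%E =
  fine (\int[mu]_(z in (Om : set (borel R d))) (f z)%:E)%E.
Proof.
move=> cOm Om0 muOm nuOm H f cf; have mOm := compact_borel cOm.
apply/eqP; rewrite -subr_eq0 -normr_le0; apply/ler_addgt0Pl => e e0; rewrite addr0.
have e2 : 0 < e / 2 by rewrite divr_gt0.
have [g gP gf] := mlp_dense cOm Om0 cf e2.
have cg := smlp_continuous gP.
have wg : {within Om, continuous g} by exact: continuous_subspaceT.
have gf' x : Om x -> `|g x - f x| <= e / 2 by move=> /gf/ltW.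
have := integral_close cOm muOm cf wg gf'.
have := integral_close cOm nuOm cf wg gf'.
rewrite -(rint_restrict mOm muOm cg) -(rint_restrict mOm nuOm cg) H//.
set A := rint _ _; set B := fine _; set C := fine _ => h1 h2.
rewrite (_ : B - C = (A - C) - (A - B)); last by lra.
by apply: le_trans (ler_normB _ _) _; lra.
Qed.

(** * The lattice hypotheses for a weak-star continuous map *)

Section WeakStar.
Context (d d' : nat) (Om : set 'cV[R]_d).
Context (Lam : probability (borel R d) R -> 'cV[R]_d -> 'cV[R]_d').
Hypothesis cOm : compact Om.
Hypothesis cLam : weakstar_continuous Om Lam.

Local Notation T := (probability (borel R d) R * 'cV[R]_d)%type.

Let D : set T := [set w : T | w.1 Om = 1%E /\ Om w.2].
Let F (i : 'I_d') (w : T) : R := Lam w.1 w.2 i 0.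

Lemma weakstar_ultra_cvg i (U : set_system T) : UltraFilter U -> U D ->
  exists p, [/\ D p, F i @ U --> F i p & forall f, elementary f -> f @ U --> f p].
Proof.
move=> UU UD.
have U1 : U [set w : T | w.1 Om = 1%E] by apply: filterS UD => w [].
have [mu muOm cmu] := probability_compact cOm UU U1.
have [x Ox cx] : exists2 x, Om x & snd @ U --> x.
  by apply: ultra_compact_cvg => //; apply: filterS UD => w [].
have mOm := compact_borel cOm.
exists (mu, x); split=> //=.
- apply/cvgrPdist_lt => e e0.
  have [N [f [delta [delta0 [cf H]]]]] := cLam muOm Ox e0.
  (* A basic neighbourhood involves finitely many test functions, so it belongs to [U]. *)
  have Uf : U [set w : T | forall j, `|fine (\int[w.1]_(z in (Om : set (borel R d))) (f j z)%:E)%E -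
      fine (\int[mu]_(z in (Om : set (borel R d))) (f j z)%:E)%E| < delta].
    apply: filter_forall => j; have /cvgrPdist_lt/(_ _ delta0) := cmu _ (cf j).
    by apply: filterS => w /=; rewrite distrC.
  (* The norm bound costs a factor [d.+1]; dividing by [d.+2] keeps the inequality strict. *)
  have d2 : 0 < delta / d.+2%:R by rewrite divr_gt0.
  have Ux : U [set w : T | forall j, `|(w.2 - x) j 0| < delta / d.+2%:R].
    apply: filter_forall => j.
    have /cvgrPdist_lt/(_ _ d2) : (fun w : T => w.2 j 0) @ U --> x j 0.
      exact: (cvg_cV_coord cx).
    apply: filterS => w /=.
    by rewrite distrC !mxE.
  apply: filterS3 UD Uf Ux => w [wOm Ow] wf wx; rewrite /F /=.
  have wxd : enorm (w.2 - x) < delta.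
    apply: (@le_lt_trans _ _ (d.+1%:R * (delta / d.+2%:R))).
      by apply: enorm_le_coord; [move=> j; exact: ltW|exact: ltW].
    by rewrite mulrCA gtr_pMr// ltr_pdivrMr// mul1r ltr_nat.
  apply: le_lt_trans (H _ _ wOm Ow wf wxd).
  have -> : Lam mu x i 0 - Lam w.1 w.2 i 0 = - (Lam w.1 w.2 - Lam mu x) i 0.
    by rewrite !mxE opprB.
  by rewrite normrN; exact: coord_le_enorm.
- move=> _ [g [g' [b [gP g'P ->]]]] /=.
  apply: cvgD; first exact: smlp_cvg gP cx.
  apply: cvgM; first exact: cvg_cst.
  have cg' := smlp_continuous g'P.
  have /cmu/cvgrPdist_lt h : {within Om, continuous g'} by exact: continuous_subspaceT.
  apply/cvgrPdist_lt => e e0.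
  apply: filterS2 (h e e0) U1 => w /= hw w1.
  by rewrite (rint_restrict mOm w1 cg') (rint_restrict mOm muOm cg').
Qed.

(** Points with different values of [F i] are separated by some elementary function, and an affine
    function of it takes the two prescribed values. *)
Lemma elementary_interpolation i p q : D p -> D q ->
  exists f, [/\ elementary f, f p = F i p & f q = F i q].
Proof.
move: p q => [mu x] [nu y] [/= muOm Ox] [/= nuOm Oy].
have [E|Fpq] := eqVneq (F i (mu, x)) (F i (nu, y)).
  by exists (fun=> F i (nu, y)); split=> //; exact: elementary_cst.
have [f fP fpq] : exists2 f, elementary f & f (mu, x) != f (nu, y).
  have [xy|/eqP xy] := pselect (x = y); last first.
    have [j xj] : exists j, x j 0 != y j 0.
      apply/existsP; apply: contraNT xy => /existsPn xy.
      by apply/eqP/colP => j; apply/eqP; have := xy j; rewrite negbK.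
    exists (fun w : T => w.2 j 0) => //.
    exists (fun z : 'cV[R]_d => z j 0), (fun=> 0), 0; split; [exact: is_smlp_coord|exact: is_smlp_cst|].
    by apply/funext => w; rewrite mul0r addr0.
  (* If no ReLU integral separated the measures, [nu] would lie in every weak-star neighbourhood of
     [mu]; as [x = y], continuity would force equal values. *)
  apply: contrapT => /forall2NP nof; move/eqP: Fpq; apply.
  have H g : is_smlp g -> rint mu g = rint nu g.
    move=> gP; apply/eqP; apply: contrapT => /negP ne.
    have [|] := nof (fun w : T => rint (w.1 : set (borel R d) -> \bar R) g).
      apply; exists (fun=> 0), g, 1; split=> //; first exact: is_smlp_cst.
      by apply/funext => w; rewrite mul1r add0r.
    by apply.
  have HI := eq_integral_of_mlp cOm (ex_intro _ x Ox) muOm nuOm H.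
  apply/esym/eqP; rewrite -subr_eq0 -normr_le0; apply/ler_addgt0Pl => e e0; rewrite addr0.
  have [N [f [delta [delta0 [cf Hf]]]]] := cLam muOm Ox e0.
  have := Hf nu y nuOm Oy.
  have -> : enorm (y - x) = 0.
    rewrite xy subrr /enorm /dotv big1 ?sqrtr0// => j _.
    by rewrite mxE mul0r.
  move=> /(_ _ delta0) h; apply: le_trans (ltW (h _)).
    have -> : F i (nu, y) - F i (mu, x) = (Lam nu y - Lam mu x) i 0 by rewrite !mxE.
    exact: coord_le_enorm.
  by move=> j; rewrite HI// subrr normr0.
have fqp : f (nu, y) - f (mu, x) != 0 by rewrite subr_eq0 eq_sym.
pose c := (F i (nu, y) - F i (mu, x)) / (f (nu, y) - f (mu, x)).
exists (fun w => F i (mu, x) - c * f (mu, x) + c * f w); split.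
- exact: elementary_affine.
- by rewrite subrK.
- by rewrite /c; field.
Qed.

Lemma network_approximation (eps : R) : (0 < d')%N -> D !=set0 -> 0 < eps ->
  exists2 N : tnet R d d', tnet_all (@within_budget R d d') N &
    forall w, D w -> enorm (tnet_eval N (w.1 : set (borel R d) -> \bar R) w.2 -
                            Lam w.1 w.2) <= eps.
Proof.
(* The coordinatewise error is multiplied by at most [d'.+1] in the norm. *)
move=> d'0 D0 eps0; pose e := eps / d'.+1%:R; have e0 : 0 < e by rewrite divr_gt0.
have /choice[f fP] i : exists f, max_computable i f /\
    forall w, D w -> `|f w - F i w| < e.
  suff [f fC fe] : exists2 f, max_computable i f & forall w, D w -> `|f w - F i w| < e.
    by exists f.
  apply: (@lattice_approximation R _ D (@elementary R d) (@min_computable R d d')) => //.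
  - by move=> U UU UD; exact: weakstar_ultra_cvg.
  - by move=> p q; exact: elementary_interpolation.
  - exact: elementary_min_computable.
  - by move=> g h; exact: min_computable_min.
  - exact: min_max_computable.
  - by move=> g h; exact: max_computable_max.
have [|N NP NE] := @max_computable_network R d d' d'0 f; first by move=> i; have [] := fP i.
exists N => // -[mu x] Dw /=; rewrite NE.
have -> : eps = d'.+1%:R * e by rewrite /e mulrC divfK.
apply: enorm_le_coord; last exact: ltW.
by move=> i; rewrite !mxE; apply: ltW; have [_] := fP i; exact.
Qed.

End WeakStar.

End Approximation.

Unset Implicit Arguments.

Theorem theorem1 (R : realType) (d d' : nat) (Om : set 'cV[R]_d)
    (Lam : probability (borel R d) R -> 'cV[R]_d -> 'cV[R]_d') :
  compact Om ->
  weakstar_continuous Om Lam ->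
  forall eps : R, 0 < eps ->
    exists N : tnet R d d',
      (forall (mu : probability (borel R d) R) (x : 'cV[R]_d),
          mu Om = 1%E -> Om x ->
          enorm (tnet_eval N (mu : set (borel R d) -> \bar R) x - Lam mu x) <= eps) /\
      tnet_all (fun din (th : att_param R din) =>
                  (din <= d + 3 * d')%N /\ dhead th = 1%N /\ kdim th = 1%N /\
                  (nheads th <= d')%N) N.
Proof.
move=> cOm cLam eps eps0.
have skipP : tnet_all (@within_budget R d d') (NetLast (skip_attention d) (MLPAff 0 0)).
  by split=> //; exact: leq_addr.
(* Without outputs the norm is that of an empty vector; the two scratch registers would exceed the
   budget [d]. *)
have [d'0|d'0] := posnP d'.
  exists (NetLast (skip_attention d) (MLPAff 0 0)); split=> // mu x _ _.
  rewrite /enorm /dotv big1 ?sqrtr0 ?ltW// => i _.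
  by have := ltn_ord i; rewrite {2}d'0.
(* If no pair is admissible, the estimate is vacuous and any network within the budget serves. *)
have [D0|noD] := pselect (exists w : probability (borel R d) R * 'cV[R]_d,
    w.1 Om = 1%E /\ Om w.2).
  have [N NP NE] := network_approximation cOm cLam d'0 D0 eps0.
  by exists N; split=> // mu x muOm Ox; exact: (NE (mu, x)).
exists (NetLast (skip_attention d) (MLPAff 0 0)); split=> // mu x muOm Ox.
by case: noD; exists (mu, x).
Qed.
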